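(* The number $r(n)$ of $(-1)$-Dyck paths of semi-length $n$ has, as $n\to\infty$, the asymptotic approximation $$r(n)\sim \frac{\rho^{-n}}{\sqrt{n^3\pi}}\cdot \frac{\sqrt{\rho(4-4\rho-4\rho^3)}}{4(-1+4\rho-2\rho^2)},$$ where $\rho$ is the smallest positive real root of $1 - 4 x + 2 x^2 + x^4$.
   Context: A Dyck path is a lattice path in the first quadrant that starts at the origin, ends on the $x$-axis, and consists of steps $U=(1,1)$ and $D=(1,-1)$ (never going below the $x$-axis). Its semi-length is its number of $U$ steps. A valley is an occurrence of two consecutive steps $DU$; the level of a valley is the $y$-coordinate of its lowest point. Let $\nu=(\nu_1,\dots,\nu_k)$ be the levels of all valleys of $P$, listed from left to right. A Dyck path is called $(-1)$-Dyck if it has at most one valley or if $\nu_{i+1}-\nu_i\ge -1$ for all $1\le i<k$. Here $f(n)\sim g(n)$ means $f(n)/g(n)\to 1$ as $n\to\infty$. Numerically $\rho\approx 0.295598$. *)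

(* Defs.v *)
From HB Require Import structures.
From mathcomp Require Import all_boot all_order all_algebra.
From mathcomp Require Import all_classical all_reals all_analysis.
From mathcomp Require Import lra ring.

Set Implicit Arguments.
Unset Strict Implicit.
Unset Printing Implicit Defensive.

Import Order.TTheory GRing.Theory Num.Theory.
Import numFieldNormedType.Exports.

Local Open Scope ring_scope.

(* Lattice paths from the origin are words over bool. *)
Local Notation U := true (only parsing).
Local Notation D := false (only parsing).

(* The y-coordinate reached after the steps of w. *)
Definition height (w : seq bool) : int :=
  (count_mem U w)%:Z - (count_mem D w)%:Z.

Definition dyck (w : seq bool) : bool :=
  all (fun i => 0 <= height (take i w)) (iota 0 (size w).+1)
  && (height w == 0).

Definition semilength (w : seq bool) : nat := count_mem U w.

(* The default values of nth make this false when i.+1 is out of range. *)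
Definition valley (w : seq bool) (i : nat) : bool :=
  (nth U w i == D) && (nth D w i.+1 == U).

Definition valley_levels (w : seq bool) : seq int :=
  [seq height (take i.+1 w) | i <- iota 0 (size w) & valley w i].

Definition m1dyck (w : seq bool) : bool :=
  let nu := valley_levels w in
  dyck w &&
  ((size nu <= 1)%N ||
   all (fun i => -1 <= nu`_i.+1 - nu`_i) (iota 0 (size nu).-1)).

(* A Dyck path of semi-length n has exactly 2n steps, see dyck_size. *)
Definition num_m1dyck (n : nat) : nat :=
  #|[set w : n.*2.-tuple bool | m1dyck w && (semilength w == n)]%SET|.

Lemma dyck_size (w : seq bool) : dyck w -> size w = (semilength w).*2.
Proof.
case/andP=> _ /eqP /subr0_eq [] e.
rewrite /semilength -addnn -[size w](count_predC (pred1 U)); congr addn.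
by rewrite [RHS]e; apply: eq_count; case.
Qed.

Definition smallest_positive_root (R : realType) (p : {poly R}) (x : R) : Prop :=
  [/\ 0 < x, root p x & forall y, 0 < y -> root p y -> x <= y].

Definition asymp_equiv (R : realType) (f g : nat -> R) : Prop :=
  ((fun n => f n / g n) @ \oo --> (1 : R))%classic.

Definition rho_poly (R : realType) : {poly R} :=
  1 - 4 *: 'X + 2 *: 'X^2 + 'X^4.
Arguments rho_poly : clear implicits.

Lemma smallest_positive_root_rho_poly (R : realType) :
  exists rho : R, smallest_positive_root (rho_poly R) rho.
Proof.
pose q : {poly R} := 'X^3 + 'X^2 + 3 *: 'X - 1.
have qE x : q.[x] = x ^+ 3 + x ^+ 2 + 3 * x - 1 by rewrite !hornerE.
have pE x : (rho_poly R).[x] = (x - 1) * q.[x].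
  by rewrite qE !(hornerD, hornerN, hornerZ, hornerXn, hornerX, hornerC); ring.
have [|x /andP[x0 x1] /rootP qx] := @poly_ivt _ q 0 1 ler01.
  by rewrite !qE; apply/andP; split; lra.
have x_gt0 : 0 < x.
  rewrite lt_neqAle x0 andbT; apply/eqP => x00.
  by move: qx; rewrite qE -x00; lra.
exists x; split => //; first by apply/rootP; rewrite pE qx mulr0.
move=> y y0 /rootP; rewrite pE => /eqP; rewrite mulf_eq0 => /orP[|/eqP qy].
  by rewrite subr_eq0 => /eqP ->.
move: qx qy; rewrite !qE => qx qy; rewrite leNgt; apply/negP => yx.
have : 0 < (x - y) * (x ^+ 2 + x * y + y ^+ 2 + x + y + 3).
  by rewrite mulr_gt0 ?subr_gt0 // !addr_gt0 ?exprn_gt0 ?mulr_gt0.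
by rewrite (_ : _ * _ = 0) ?ltxx // -[RHS](subrr 0) -{1}qx -qy; ring.
Qed.

(* Main.v *)
Require Import Defs.
From HB Require Import structures.
From mathcomp Require Import all_boot all_order all_algebra.
From mathcomp Require Import all_classical all_reals all_analysis.
From mathcomp Require Import lra ring zify.

Set Implicit Arguments.
Unset Strict Implicit.
Unset Printing Implicit Defensive.

Import Order.TTheory GRing.Theory Num.Theory.
Import numFieldNormedType.Exports.

Local Open Scope ring_scope.

(** Cutting a nonempty Dyck path at its first return gives U P1 D P2. If P2 is
    not empty, its start is a valley at level 0, so the condition on drops
    forces P1 to have no valley or a last valley at level 0 (relative to its
    own axis); call such (-1)-Dyck paths grounded. With F and Q the generating
    functions of the (-1)-Dyck paths and of the grounded ones,
      F = 1 + x (F + Q (F - 1)),   Q = 1 / (1 - x) + x Q (Q - 1).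
    Solving the quadratic equation ([dyckQ_quad], [dyckD_sqr], [dyckf_num]),
      2 (1 - 4x + 2x^2) (F - 1) = S - (1 - x) (1 - 3x),
      S^2 = p(x) = 1 - 4x + 2x^2 + x^4.

    The coefficients are estimated by real convolution arguments instead of
    singularity analysis. All series are rescaled by x = rho X, which puts the
    dominant singularity at 1: then p = (1 - X) h, and S = sqrt(1 - X) T with
    T^2 = h. The coefficients of sqrt(1 - X) are, up to a shift, the numbers
    - w_n / 2, where w_n is the Catalan number divided by 4^n ([sqrt1X_sqr]),
    and w_n sqrt(n^3 pi) tends to 1 by Wallis' product ([catw_cvg]).
    Since 1 - h has nonnegative coefficients with sum at most 1 at X = 2, the
    coefficients of T are at most 2^-n in absolute value ([coef_dyckT_le]), and
    T(1)^2 = h(1) ([dyckT_sum]). Convolution with a geometrically decreasing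
    sequence multiplies the asymptotics by its sum ([cvg_conv]), so
    S_n / w_n tends to - T(1) / 2.

    It remains to divide by 1 - 4x + 2x^2 = (1 - uX) (1 - vX), where
    0 <= v < 1 < u. Division by 1 - vX is a convolution with a geometric
    sequence. The zero 1/u lies inside the disc of convergence and is cancelled
    by the numerator. This cancellation follows from the boundedness of the
    coefficients of F - 1 after rescaling, which the functional equations give
    ([psum_dyckQ], [psum_dyckf]); the coefficients of the quotient are then the
    tails of the numerator, which again have the order of w_n
    ([cvg_div_gt1]). As (u - 1) (1 - v) = rho^4, the limit of
    F_n rho^n / w_n is T(1) / (4 rho^4) ([dyckf_cvg]). *)

(** * Dyck words and binary trees *)

(** Binary trees encode Dyck words by first-return decomposition: [Node l r]
    stands for U l D r. *)
Inductive tree := Leaf | Node (l r : tree).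

(** The Dyck word of a tree. *)
Fixpoint word (t : tree) : seq bool :=
  if t is Node l r then true :: word l ++ false :: word r else [::].

(** The stack of trees t0, ..., th such that the word read is
    t0 D t1 D ... D th; a word that is a suffix of a Dyck word and starts at
    height h has such a reading. *)
Fixpoint parse (w : seq bool) : seq tree :=
  if w is a :: w' then
    let ts := parse w' in
    if a then if ts is t0 :: t1 :: ts' then Node t0 t1 :: ts' else ts
    else Leaf :: ts
  else [:: Leaf].

Lemma parse_word_cat t s ts :
  parse s = Leaf :: ts -> parse (word t ++ s) = t :: ts.
Proof.
elim: t s ts => [|l IHl r IHr] s ts //= pE.
by rewrite -catA (IHl _ (r :: ts)) //= (IHr _ ts).
Qed.

Lemma wordK : cancel word (fun w => head Leaf (parse w)).
Proof. by move=> t; rewrite -[word t]cats0 (@parse_word_cat _ _ [::]). Qed.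

HB.instance Definition _ := Countable.copy tree (can_type wordK).

(** The number of nodes. *)
Fixpoint tsize (t : tree) : nat :=
  if t is Node l r then (tsize l + tsize r).+1 else 0.

Lemma semilength_word t : semilength (word t) = tsize t.
Proof.
rewrite /semilength; elim: t => //= l IHl r IHr.
by rewrite count_cat /= IHl IHr.
Qed.

(** The change of height along a step. *)
Definition step (a : bool) : int := if a then 1 else -1.

Lemma height_cons a w : height (a :: w) = step a + height w.
Proof. by rewrite /height /step; case: a => /=; lia. Qed.

(** Paths that start at height [h], stay nonnegative and end on the axis. *)
Fixpoint dyck_from (h : nat) (w : seq bool) : bool :=
  if w is a :: w' then
    if a then dyck_from h.+1 w' else if h is h'.+1 then dyck_from h' w' else false
  else h == 0%N.

Lemma all_iotaS (P : pred nat) n :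
  all P (iota 0 n.+1) = P 0%N && all (fun i => P i.+1) (iota 0 n).
Proof. by rewrite /= -[1%N]/(1 + 0)%N iotaDl all_map. Qed.

Lemma dyck_fromE h w :
  all (fun i => 0 <= h%:Z + height (take i w)) (iota 0 (size w).+1)
  && (h%:Z + height w == 0) = dyck_from h w.
Proof.
elim: w h => [|a w IH] h; first by rewrite /= /height /=; lia.
rewrite all_iotaS take0 (_ : height [::] = 0) // addr0 (_ : 0 <= h%:Z) // andTb.
rewrite (@eq_all _ _ (fun i => 0 <= (h%:Z + step a) + height (take i w))); last first.
  by move=> i; rewrite /= height_cons addrA.
rewrite height_cons addrA.
case: a => /=; first by rewrite -IH (_ : h%:Z + 1 = h.+1%:Z); last lia.
case: h => [|h]; first by rewrite take0.
by rewrite -IH (_ : h.+1%:Z + -1 = h%:Z); last lia.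
Qed.

Lemma dyckE w : dyck w = dyck_from 0 w.
Proof.
rewrite -dyck_fromE /dyck add0r; congr (_ && _).
by apply: eq_all => i; rewrite add0r.
Qed.

Lemma dyck_from_word t h s : dyck_from h (word t ++ s) = dyck_from h s.
Proof. by elim: t h s => //= l IHl r IHr h s; rewrite -catA IHl /= IHr. Qed.

Lemma dyck_word t : dyck (word t).
Proof. by rewrite dyckE -[word t]cats0 dyck_from_word. Qed.

(** Parsing inverts [word] on Dyck words, so every Dyck word comes from a
    tree. *)
Lemma dyck_from_parse h w : dyck_from h w ->
  size (parse w) = h.+1 /\
  w = word (head Leaf (parse w)) ++
      flatten [seq false :: word t | t <- behead (parse w)].
Proof.
elim: w h => [|[] w IH] h /=; first by move/eqP->.
- move=> /IH[]; case: (parse w) => [|t0 [|t1 ts]] //= [sE] {1}->; split=> //.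
    by rewrite sE.
  by rewrite -catA.
- case: h => // h /IH[sE wE]; split; first by rewrite sE.
  by case: (parse w) sE wE => //= t ts _ <-.
Qed.

Lemma dyckK w : dyck w -> word (head Leaf (parse w)) = w.
Proof.
rewrite dyckE => /dyck_from_parse[].
by case: (parse w) => [|t [|]] //= _ ->; rewrite cats0.
Qed.

(** * Valley levels of the word of a tree *)

(** The valley levels of a path that starts at height [h]. *)
Fixpoint levels_from (h : int) (w : seq bool) : seq int :=
  if w is a :: w' then
    let h' := h + step a in
    (if ~~ a && head false w' then [:: h'] else [::]) ++ levels_from h' w'
  else [::].

Lemma map_filter_iotaS T (f : nat -> T) (P : pred nat) n :
  [seq f i | i <- iota 0 n.+1 & P i] =
  (if P 0%N then [:: f 0%N] else [::])
  ++ [seq f i.+1 | i <- iota 0 n & P i.+1].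
Proof.
rewrite /= -[1%N]/(1 + 0)%N iotaDl filter_map.
by case: ifP => _ /=; rewrite -map_comp.
Qed.

Lemma levels_fromE h w :
  [seq h + height (take i.+1 w) | i <- iota 0 (size w) & valley w i]
  = levels_from h w.
Proof.
elim: w h => [|a w IH] h //.
rewrite [size _]/= map_filter_iotaS /= -IH.
have -> : valley (a :: w) 0 = ~~ a && head false w.
  by rewrite /valley /= nth0; case: a => //=; case: (head _ _).
rewrite take0 (_ : height [:: a] = step a); last first.
  by rewrite height_cons addr0.
by congr (_ ++ _); apply: eq_map => i; rewrite height_cons addrA.
Qed.

(** The valley levels of the word of a tree, started at height [h]; the valley
    between the two subtrees exists when the right one is not empty. *)
Fixpoint tlevels (h : int) (t : tree) : seq int :=
  if t is Node l r then
    tlevels (h + 1) l ++ (if r is Leaf then [::] else h :: tlevels h r)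
  else [::].

Lemma levels_from_word t h s : ~~ head false s ->
  levels_from h (word t ++ s) = tlevels h t ++ levels_from h s.
Proof.
elim: t h s => [|l IHl r IHr] h s //= sD.
rewrite -catA IHl //= -catA; congr (_ ++ _).
have -> : h + 1 + -1 = h by lia.
rewrite IHr //; case: r {IHr} => [|r1 r2] //=.
by rewrite (negPf sD).
Qed.

Lemma valley_levels_word t : valley_levels (word t) = tlevels 0 t.
Proof.
have := @levels_from_word t 0 [::] isT; rewrite /= !cats0 => <-.
rewrite -levels_fromE; apply: eq_map => i; by rewrite add0r.
Qed.

Lemma tlevels_shift h t : tlevels h t = [seq h + x | x <- tlevels 0 t].
Proof.
elim: t h => [|l IHl r IHr] h //=.
rewrite (IHl (h + 1)) (IHl (0 + 1)) map_cat -map_comp; congr (_ ++ _).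
  by apply: eq_map => x /=; lia.
by case: r IHr => //= r1 r2 IHr; rewrite IHr addr0.
Qed.

Lemma tlevels_ge h t : all (fun x => h <= x) (tlevels h t).
Proof.
elim: t h => [|l IHl r IHr] h //=; rewrite all_cat; apply/andP; split.
  by apply: sub_all (IHl (h + 1)) => x; lia.
by case: r IHr => //= r1 r2 IHr; rewrite lexx /=; apply: IHr.
Qed.

(** The condition on the levels of two consecutive valleys. *)
Definition drop_le1 (a b : int) : bool := -1 <= b - a.

(** Trees whose valley levels never drop by more than one. *)
Definition good (t : tree) : bool := sorted drop_le1 (tlevels 0 t).

Lemma m1dyck_word t : m1dyck (word t) = good t.
Proof.
rewrite /m1dyck dyck_word valley_levels_word /good /=.
move: (tlevels 0 t) => s; apply/orP/(sortedP 0).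
  move=> [s1 i si|/allP sP i si]; first by have := leq_trans si s1.
  by apply: sP; rewrite mem_iota add0n ltn_predRL.
move=> sP; right; apply/allP => i; rewrite mem_iota => /andP[_ si].
by apply: sP; rewrite -ltn_predRL -[(size s).-1]add0n.
Qed.

Lemma good_shift h t : sorted drop_le1 (tlevels h t) = good t.
Proof.
rewrite tlevels_shift sorted_map /good; apply: eq_sorted => x y.
by rewrite /= /drop_le1; lia.
Qed.

(** Trees without valleys: the words U^n D^n. *)
Definition pyramid (t : tree) : bool := tlevels 0 t == [::].

(** The grounded paths: good trees with no valley or whose last valley has
    level zero; without valleys, [last] returns its default 0. *)
Definition ground (t : tree) : bool := good t && (last 0 (tlevels 0 t) == 0).

Lemma tlevels_last h t : (last h (tlevels h t) == h) = (last 0 (tlevels 0 t) == 0).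
Proof. by rewrite tlevels_shift -{1}[h]addr0 last_map -subr_eq0 addrAC subrr add0r. Qed.

Lemma pyramid_shift h t : (tlevels h t == [::]) = pyramid t.
Proof. by rewrite tlevels_shift /pyramid; case: (tlevels 0 t). Qed.

Lemma pyramid_node l r : pyramid (Node l r) = pyramid l && (r == Leaf).
Proof.
rewrite -(pyramid_shift (0 + 1) l) /pyramid /=.
by case: r => [|r1 r2]; [rewrite cats0 andbT | rewrite andbF; case: (tlevels _ l)].
Qed.

(** The drop from the last valley of [l], if any, to the valley at level 0
    that separates it from a nonempty [r] is at most 1 only from level 1. *)
Lemma good_node l r :
  good (Node l r) = if r == Leaf then good l else ground l && good r.
Proof.
case: r => [|r1 r2]; first by rewrite {1}/good /= cats0 good_shift.
set r := Node r1 r2.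
rewrite [RHS]/= /good [tlevels 0 (Node l r)]/= -[0 :: tlevels 0 r]cat1s.
have rE : path drop_le1 0 (tlevels 0 r) = good r.
  rewrite /good; have := tlevels_ge 0 r; case: (tlevels 0 r) => //= x s.
  by rewrite /drop_le1 => /andP[x0 _]; rewrite subr0 (le_trans _ x0).
rewrite /ground -(good_shift (0 + 1)) -(tlevels_last (0 + 1)).
have := tlevels_ge (0 + 1) l; case: (tlevels (0 + 1) l) => [|x s] lge.
  by rewrite /= rE.
rewrite cat_cons /sorted cat_path /= rE /=.
rewrite -andbA; congr (_ && _); congr (_ && _).
have : 1 <= last x s by apply: (allP lge); rewrite mem_last.
by rewrite /drop_le1; lia.
Qed.

Lemma ground_node l r :
  ground (Node l r) = if r == Leaf then pyramid l else ground l && ground r.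
Proof.
rewrite {1}/ground good_node; case: r => [|r1 r2] /=.
  rewrite cats0 -(good_shift (0 + 1)) -(pyramid_shift (0 + 1)).
  have := tlevels_ge (0 + 1) l; case: (tlevels (0 + 1) l) => [|x s] lge //=.
  have : 1 <= last x s by apply: (allP lge); rewrite mem_last.
  by rewrite andbC; case: eqP => [->|].
rewrite last_cat /= -andbA; congr (_ && _).
Qed.

(** * Enumeration of the trees of a given size *)

(** The trees of size [n], provided that [n < fuel]. *)
Fixpoint trees_rec (fuel n : nat) : seq tree :=
  if fuel is fuel'.+1 then
    if n is n'.+1 then
      flatten [seq [seq Node l r | l <- trees_rec fuel' k, r <- trees_rec fuel' (n' - k)]
              | k <- iota 0 n'.+1]
    else [:: Leaf]
  else [::].

(** All the trees with [n] nodes, without repetition. *)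
Definition trees n := trees_rec n.+1 n.

Lemma trees_recS fuel n : trees_rec fuel.+1 n.+1 =
  flatten [seq [seq Node l r | l <- trees_rec fuel k, r <- trees_rec fuel (n - k)]
          | k <- iota 0 n.+1].
Proof. by []. Qed.

Lemma mem_trees_rec fuel n t : (n < fuel)%N ->
  (t \in trees_rec fuel n) = (tsize t == n).
Proof.
elim: fuel n t => // fuel IH [|n] t nf; first by rewrite /= inE; case: t.
rewrite trees_recS; apply/flatten_mapP/eqP.
  move=> [k]; rewrite mem_iota => kn /allpairsP[[l r] /= [lk rk ->]] /=.
  by move: lk rk; rewrite !IH; lia.
case: t => [|l r] // [lr]; exists (tsize l); first by rewrite mem_iota; lia.
by apply: allpairs_f; rewrite IH; lia.
Qed.

Lemma uniq_trees_rec fuel n : (n < fuel)%N -> uniq (trees_rec fuel n).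
Proof.
elim: fuel n => // fuel IH [|n] nf //.
rewrite trees_recS.
have sub : forall k, k \in iota 0 n.+1 -> (k < n.+1)%N.
  by move=> k; rewrite mem_iota.
elim: (iota 0 n.+1) (iota_uniq 0 n.+1) sub => //= k s IHs /andP[kNs us] ks.
rewrite cat_uniq IHs //; last by move=> j js; apply: ks; rewrite inE js orbT.
have kn : (k < n.+1)%N by apply: ks; rewrite inE eqxx.
rewrite andbT; apply/andP; split.
  by apply: allpairs_uniq => [||[? ?] [? ?] _ _ [-> ->]] //; apply: IH; lia.
apply/hasPn => t /flatten_mapP[j js /allpairsP[[l r] /= [lj rj ->]]].
apply/negP => /allpairsP[[l' r'] /= [lk rk [ll' rr']]].
have jn : (j < n.+1)%N by apply: ks; rewrite inE js orbT.
move: lk lj; rewrite -ll' !mem_trees_rec; try lia.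
by move=> /eqP kE /eqP jE; move: kNs; rewrite -kE jE js.
Qed.

Lemma mem_trees n t : (t \in trees n) = (tsize t == n).
Proof. exact: mem_trees_rec. Qed.

Lemma uniq_trees n : uniq (trees n).
Proof. exact: uniq_trees_rec. Qed.

(** The number of trees of size [n] satisfying [P]. *)
Definition ntrees (P : pred tree) (n : nat) : nat := count P (trees n).

Lemma ntrees0 P : ntrees P 0 = P Leaf.
Proof. by rewrite /ntrees /= addn0. Qed.

Lemma trees_recE fuel n : (n < fuel)%N -> perm_eq (trees_rec fuel n) (trees n).
Proof.
move=> nf; apply: uniq_perm; [exact: uniq_trees_rec|exact: uniq_trees|].
by move=> t; rewrite mem_trees mem_trees_rec.
Qed.

Lemma ntreesS P n : ntrees P n.+1 =
  (\sum_(k < n.+1) \sum_(l <- trees k) ntrees (fun r => P (Node l r)) (n - k))%N.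
Proof.
rewrite /ntrees /trees trees_recS -[RHS](big_mkord xpredT
  (fun k => \sum_(l <- trees k) ntrees (fun r => P (Node l r)) (n - k))%N).
rewrite /index_iota subn0 count_flatten sumnE big_map big_map.
rewrite big_seq [RHS]big_seq; apply: eq_bigr => k; rewrite mem_iota => kn.
rewrite count_flatten sumnE !big_map.
rewrite (perm_big (trees k)); last by apply: trees_recE; lia.
apply: eq_bigr => l _; rewrite count_map /ntrees.
have /permP -> // : perm_eq (trees_rec n.+1 (n - k)) (trees (n - k)).
by apply: trees_recE; lia.
Qed.

(** If the condition on a node splits according to whether the right subtree
    is a leaf, the numbers of trees satisfy a convolution recurrence. *)
Lemma ntrees_split (P A B C : pred tree) n :
  (forall l r, P (Node l r) = if r == Leaf then A l else B l && C r) ->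
  ntrees P n.+1 =
  (ntrees A n + \sum_(k < n) ntrees B k * ntrees C (n - k))%N.
Proof.
move=> PE; rewrite ntreesS big_ord_recr /= addnC; congr (_ + _)%N.
  rewrite subnn /ntrees -sumn_count sumnE big_map; apply: eq_bigr => l _.
  by rewrite /= PE eqxx addn0.
apply: eq_bigr => k _.
rewrite {2}/ntrees -sumn_count sumnE big_map big_distrl /=.
apply: eq_bigr => l _; rewrite /ntrees.
rewrite (@eq_in_count _ _ (fun r => B l && C r)); last first.
  move=> r; rewrite mem_trees PE => rk; case: eqP => // rL.
  by move: rk (ltn_ord k); rewrite rL /=; lia.
by case: (B l) => /=; rewrite ?mul1n // count_pred0.
Qed.

Lemma ntrees_pyramid n : ntrees pyramid n = 1%N.
Proof.
elim: n => [|n IH]; first by rewrite ntrees0.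
rewrite (@ntrees_split _ pyramid pred0 pred0); last first.
  by move=> l r; rewrite pyramid_node; case: (r == Leaf); rewrite ?andbT ?andbF.
by rewrite IH big1 // => k _; rewrite /ntrees count_pred0.
Qed.

Lemma ntrees_good n : ntrees good n.+1 =
  (ntrees good n + \sum_(k < n) ntrees ground k * ntrees good (n - k))%N.
Proof. by apply: ntrees_split => l r; rewrite good_node. Qed.

Lemma ntrees_ground n : ntrees ground n.+1 =
  (1 + \sum_(k < n) ntrees ground k * ntrees ground (n - k))%N.
Proof.
by rewrite -(ntrees_pyramid n); apply: ntrees_split => l r; rewrite ground_node.
Qed.

Lemma num_m1dyckE n : num_m1dyck n = ntrees good n.
Proof.
rewrite /num_m1dyck /ntrees -size_filter -(size_map word) cardE -(size_map val).
apply: perm_size; apply: uniq_perm.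
- by rewrite (map_inj_uniq val_inj) enum_uniq.
- by rewrite (map_inj_uniq (can_inj wordK)) filter_uniq // uniq_trees.
move=> w; apply/mapP/mapP.
  move=> [v]; rewrite mem_enum inE => /andP[vm /eqP vn] ->.
  have /andP[vd _] := vm.
  exists (head Leaf (parse v)); last by rewrite dyckK.
  by rewrite mem_filter -m1dyck_word dyckK // vm mem_trees -semilength_word dyckK // vn eqxx.
move=> [t]; rewrite mem_filter mem_trees => /andP[gt /eqP tn] ->.
have st : size (word t) == n.*2 by rewrite dyck_size ?dyck_word // semilength_word tn.
exists (Tuple st) => //.
by rewrite mem_enum inE m1dyck_word gt semilength_word tn /=.
Qed.

(** * Formal power series *)

(** Formal power series over a field, given by their coefficients; the record
    avoids the pointwise ring structure of functions. *)
Record fps (R : fieldType) := Fps { coefs : nat -> R }.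

Section FpsRing.
Variable R : fieldType.
Implicit Types a b c : fps R.

HB.instance Definition _ := gen_eqMixin (fps R).
HB.instance Definition _ := gen_choiceMixin (fps R).

Definition fps_coef (n : nat) (a : fps R) : R := coefs a n.

Lemma fpsP a b : (forall n, fps_coef n a = fps_coef n b) -> a = b.
Proof.
by case: a b => [a] [b] ab; congr Fps; apply/funext => n; apply: ab.
Qed.

(** The constant series, an embedding of the field. *)
Definition fps_const (x : R) : fps R := Fps (fun n => if n is 0 then x else 0).
Definition fps_add a b := Fps (fun n => fps_coef n a + fps_coef n b).
Definition fps_opp a := Fps (fun n => - fps_coef n a).
Definition fps_mul a b :=
  Fps (fun n => \sum_(i < n.+1) fps_coef i a * fps_coef (n - i) b).

Fact fps_addA : associative fps_add.
Proof. by move=> a b c; apply: fpsP => n /=; apply: addrA. Qed.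
Fact fps_addC : commutative fps_add.
Proof. by move=> a b; apply: fpsP => n /=; apply: addrC. Qed.
Fact fps_add0 : left_id (fps_const 0) fps_add.
Proof. by move=> a; apply: fpsP => -[|n] /=; apply: add0r. Qed.
Fact fps_addN : left_inverse (fps_const 0) fps_opp fps_add.
Proof. by move=> a; apply: fpsP => -[|n] /=; apply: addNr. Qed.

HB.instance Definition _ :=
  GRing.isZmodule.Build (fps R) fps_addA fps_addC fps_add0 fps_addN.

(** The product is compared with that of polynomials via truncations. *)
Definition fps_trunc (N : nat) a : {poly R} := \poly_(i < N) fps_coef i a.

Fact coef_fps_mul N a b n : (n < N)%N ->
  fps_coef n (fps_mul a b) = (fps_trunc N a * fps_trunc N b)`_n.
Proof.
move=> nN; rewrite coefM /=; apply: eq_bigr => i _; rewrite !coef_poly.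
by rewrite !ifT //; have := ltn_ord i; lia.
Qed.

Fact coef_polyM_trunc (p p' q q' : {poly R}) n :
  (forall i, (i <= n)%N -> p`_i = p'`_i) -> (forall i, (i <= n)%N -> q`_i = q'`_i) ->
  (p * q)`_n = (p' * q')`_n.
Proof.
move=> pp qq; rewrite !coefM; apply: eq_bigr => i _.
by rewrite pp ?qq ?leq_subr // -ltnS.
Qed.

Fact coef_trunc N a n : (n < N)%N -> (fps_trunc N a)`_n = fps_coef n a.
Proof. by move=> nN; rewrite coef_poly nN. Qed.

Fact fps_mulC : commutative fps_mul.
Proof.
by move=> a b; apply: fpsP => n; rewrite !(@coef_fps_mul n.+1) // mulrC.
Qed.

Fact fps_mulA : associative fps_mul.
Proof.
move=> a b c; apply: fpsP => n; rewrite !(@coef_fps_mul n.+1) //.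
transitivity ((fps_trunc n.+1 a * (fps_trunc n.+1 b * fps_trunc n.+1 c))`_n).
  apply: coef_polyM_trunc => // i ni.
  by rewrite coef_trunc // (@coef_fps_mul n.+1).
rewrite mulrA; apply: coef_polyM_trunc => // i ni.
by rewrite coef_trunc // (@coef_fps_mul n.+1).
Qed.

Fact fps_mul1 : left_id (fps_const 1) fps_mul.
Proof.
move=> a; apply: fpsP => n /=; rewrite big_ord_recl /= mul1r subn0.
by rewrite big1 ?addr0 // => i _; rewrite mul0r.
Qed.

Fact fps_mulDl : left_distributive fps_mul fps_add.
Proof.
move=> a b c; apply: fpsP => n /=; rewrite -big_split /=.
by apply: eq_bigr => i _; rewrite mulrDl.
Qed.

Fact fps_1neq0 : fps_const 1 != 0.
Proof. by apply/eqP => /(congr1 (fps_coef 0)) /= /eqP; rewrite oner_eq0. Qed.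

HB.instance Definition _ := GRing.Zmodule_isComNzRing.Build (fps R)
  fps_mulA fps_mulC fps_mul1 fps_mulDl fps_1neq0.

Lemma coef_fpsD a b n : fps_coef n (a + b) = fps_coef n a + fps_coef n b.
Proof. by []. Qed.
Lemma coef_fpsN a n : fps_coef n (- a) = - fps_coef n a.
Proof. by []. Qed.
Lemma coef_fpsB a b n : fps_coef n (a - b) = fps_coef n a - fps_coef n b.
Proof. by []. Qed.
Lemma coef_fpsM a b n :
  fps_coef n (a * b) = \sum_(i < n.+1) fps_coef i a * fps_coef (n - i) b.
Proof. by []. Qed.
Lemma coef_fps0 n : fps_coef n (0 : fps R) = 0.
Proof. by case: n. Qed.
Lemma coef_fpsC x n : fps_coef n (fps_const x) = (if n is 0 then x else 0).
Proof. by []. Qed.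
Lemma coef_fps1 n : fps_coef n (1 : fps R) = (n == 0%N)%:R.
Proof. by case: n. Qed.

Lemma coef_fpsCM x a n : fps_coef n (fps_const x * a) = x * fps_coef n a.
Proof.
rewrite coef_fpsM big_ord_recl /= subn0.
by rewrite big1 ?addr0 // => i _; rewrite mul0r.
Qed.

Fact fps_const_additive : {morph fps_const : x y / x - y}.
Proof. by move=> x y; apply: fpsP => -[|n] //=; rewrite ?subrr ?coef_fpsB //= subrr. Qed.
Fact fps_const_multiplicative : GRing.monoid_morphism fps_const.
Proof.
split=> // x y; apply: fpsP => n; rewrite coef_fpsCM.
by case: n => //= n; rewrite mulr0.
Qed.

HB.instance Definition _ := GRing.isZmodMorphism.Build R (fps R) fps_const
  fps_const_additive.
HB.instance Definition _ := GRing.isMonoidMorphism.Build R (fps R) fps_const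
  fps_const_multiplicative.

(** The indeterminate. *)
Definition fpsX : fps R := Fps (fun n => (n == 1%N)%:R).

Lemma coef_fpsXM a n :
  fps_coef n (fpsX * a) = if n is n'.+1 then fps_coef n' a else 0.
Proof.
case: n => [|n]; first by rewrite coef_fpsM big_ord1 /= mul0r.
rewrite coef_fpsM 2!big_ord_recl /= mul0r add0r mul1r subn1 /=.
by rewrite big1 ?addr0 // => i _; rewrite mul0r.
Qed.

Lemma fps_mulX_inj a b : fpsX * a = fpsX * b -> a = b.
Proof.
move=> ab; apply: fpsP => n.
by have := congr1 (fps_coef n.+1) ab; rewrite !coef_fpsXM.
Qed.

(** A series with nonzero constant coefficient can be cancelled. *)
Lemma fps_mul_eq0 a b : fps_coef 0 a != 0 -> a * b = 0 -> b = 0.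
Proof.
move=> a0 ab; apply: fpsP => n; rewrite coef_fps0.
elim/ltn_ind: n => n IH; have := congr1 (fps_coef n) ab.
rewrite coef_fpsM coef_fps0 big_ord_recl /= subn0 big1 ?addr0 => [/eqP|i _].
  by rewrite mulf_eq0 (negPf a0) => /eqP.
by rewrite [fps_coef _ b]IH ?mulr0 //= /bump /=; have := ltn_ord i; lia.
Qed.

Lemma fps_mulI a b c : fps_coef 0 a != 0 -> a * b = a * c -> b = c.
Proof.
move=> a0 abc; apply/eqP; rewrite -subr_eq0; apply/eqP.
by apply: (fps_mul_eq0 a0); rewrite mulrBr abc subrr.
Qed.

(** The geometric series with ratio [x]. *)
Definition fps_geom (x : R) : fps R := Fps (fun n => x ^+ n).

Lemma fps_geomE x : (1 - fps_const x * fpsX) * fps_geom x = 1.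
Proof.
apply: fpsP => n; rewrite mulrBl mul1r -mulrA coef_fpsB coef_fpsCM coef_fpsXM.
by case: n => [|n]; rewrite coef_fps1 /= ?mulr0 ?subr0 // exprS subrr.
Qed.

(** The formal derivative. *)
Definition fps_deriv a : fps R := Fps (fun n => n.+1%:R * fps_coef n.+1 a).

Lemma coef_fps_deriv a n :
  fps_coef n (fps_deriv a) = n.+1%:R * fps_coef n.+1 a.
Proof. by []. Qed.

Lemma fps_derivM a b :
  fps_deriv (a * b) = fps_deriv a * b + a * fps_deriv b.
Proof.
apply: fpsP => n; rewrite coef_fpsD !coef_fpsM /= mulr_sumr.
transitivity (\sum_(i < n.+2) (i%:R * fps_coef i a * fps_coef (n.+1 - i) b
   + fps_coef i a * ((n.+1 - i)%:R * fps_coef (n.+1 - i) b))).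
  apply: eq_bigr => i _.
  rewrite -[X in X%:R * _](@subnKC i n.+1) -1?ltnS ?ltn_ord // natrD.
  by ring.
rewrite big_split /=; congr (_ + _).
  rewrite big_ord_recl !mul0r add0r; apply: eq_bigr => i _.
  by rewrite lift0 subSS.
rewrite big_ord_recr /= subnn !(mul0r, mulr0) addr0; apply: eq_bigr => i _.
by rewrite subSn // -ltnS.
Qed.

End FpsRing.

(** * Partial sums of power series *)

Section PartialSums.
Variable R : realFieldType.
Implicit Types (a b : fps R) (x : R) (N : nat).

(** The sum of the terms of degree less than [N] at the point [x]. *)
Definition fps_psum N x a : R := \sum_(i < N) fps_coef i a * x ^+ i.

Lemma fps_psumD N x a b : fps_psum N x (a + b) = fps_psum N x a + fps_psum N x b.
Proof.
by rewrite /fps_psum -big_split; apply: eq_bigr => i _; rewrite /= mulrDl.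
Qed.

Lemma fps_psumN N x a : fps_psum N x (- a) = - fps_psum N x a.
Proof. by rewrite /fps_psum -sumrN; apply: eq_bigr => i _; rewrite /= mulNr. Qed.

Lemma fps_psumCM N x y a : fps_psum N x (fps_const y * a) = y * fps_psum N x a.
Proof.
by rewrite /fps_psum mulr_sumr; apply: eq_bigr => i _; rewrite coef_fpsCM mulrA.
Qed.

Lemma fps_psumXM N x a : fps_psum N.+1 x (fpsX R * a) = x * fps_psum N x a.
Proof.
rewrite /fps_psum big_ord_recl coef_fpsXM mul0r add0r mulr_sumr.
by apply: eq_bigr => i _; rewrite coef_fpsXM lift0 exprS mulrCA.
Qed.

Lemma fps_psumC N x y : fps_psum N.+1 x (fps_const y) = y.
Proof.
rewrite /fps_psum big_ord_recl /= mulr1 big1 ?addr0 // => i _.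
by rewrite /= mul0r.
Qed.

(** Nonnegativity of all coefficients. *)
Definition fps_ge0 a : Prop := forall n, 0 <= fps_coef n a.

Lemma fps_psum_ge0 N x a : 0 <= x -> fps_ge0 a -> 0 <= fps_psum N x a.
Proof. by move=> x0 a0; apply: sumr_ge0 => i _; rewrite mulr_ge0 ?exprn_ge0. Qed.

Lemma fps_geM a b : fps_ge0 a -> fps_ge0 b -> fps_ge0 (a * b).
Proof.
by move=> a0 b0 n; rewrite coef_fpsM sumr_ge0 // => i _; rewrite mulr_ge0.
Qed.

Lemma le_fps_psum M N x a : 0 <= x -> fps_ge0 a -> (M <= N)%N ->
  fps_psum M x a <= fps_psum N x a.
Proof.
move=> x0 a0 MN; rewrite /fps_psum -(subnKC MN) big_split_ord /= lerDl.
by apply: sumr_ge0 => i _; rewrite mulr_ge0 ?exprn_ge0.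
Qed.

Lemma horner_fps_trunc N x a : (fps_trunc N a).[x] = fps_psum N x a.
Proof.
by rewrite horner_poly.
Qed.

(** For nonnegative coefficients, the partial sum of a product is at most the
    product of the partial sums. *)
Lemma fps_psumM_le N x a b : 0 <= x -> fps_ge0 a -> fps_ge0 b ->
  fps_psum N x (a * b) <= fps_psum N x a * fps_psum N x b.
Proof.
move=> x0 a0 b0; rewrite -!horner_fps_trunc -hornerM.
set p := fps_trunc N a * fps_trunc N b.
rewrite [leLHS]horner_fps_trunc (@horner_coef_wide _ (N + N) p); last first.
  apply: leq_trans (size_polyMleq _ _) _.
  by apply: (leq_trans (leq_pred _)); apply: leq_add; apply: size_poly.
rewrite big_split_ord /=.
rewrite -[leLHS]addr0 lerD //.
  rewrite le_eqVlt; apply/orP; left; apply/eqP; apply: eq_bigr => i _.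
  by rewrite -(@coef_fps_mul _ N).
apply: sumr_ge0 => i _; rewrite mulr_ge0 ?exprn_ge0 //.
rewrite coefM sumr_ge0 // => j _; rewrite !coef_poly.
by rewrite mulr_ge0 //; case: ifP.
Qed.

Lemma fps_psum_geom N x : fps_psum N 1 (fps_geom x) * (1 - x) = 1 - x ^+ N.
Proof.
elim: N => [|N IH]; first by rewrite /fps_psum big_ord0 mul0r expr0 subrr.
by rewrite /fps_psum big_ord_recr /= mulrDl IH expr1n exprS; ring.
Qed.

(** If [M] has no constant term and [M = (k + M^2) / 2], that is, if
    [1 - M] is the square root of [1 - k], then [M] is nonnegative when [k] is,
    and the partial sums of [M] at [x] are at most 1 when those of [k] are. *)
Lemma fps_sqrt_ge0 k M : fps_ge0 k -> fps_coef 0 M = 0 ->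
  M + M = k + M * M -> fps_ge0 M.
Proof.
move=> k0 M0 ME n; elim/ltn_ind: n => n IH.
have := congr1 (fps_coef n) ME; rewrite !coef_fpsD coef_fpsM => E.
have : 0 <= fps_coef n M + fps_coef n M; last by lra.
rewrite E addr_ge0 // sumr_ge0 // => i _.
case: (posnP i) => [->|i0]; first by rewrite M0 mul0r.
have [->|ni] := eqVneq (i : nat) n; first by rewrite subnn M0 mulr0.
by rewrite mulr_ge0 // IH //; have := ltn_ord i; lia.
Qed.

Lemma fps_sqrt_psum k M x : 0 < x -> fps_ge0 k -> fps_coef 0 M = 0 ->
  M + M = k + M * M -> (forall N, fps_psum N x k <= 1) ->
  forall N, fps_psum N x M <= 1.
Proof.
move=> x0 k0 M0 ME k1; have Mge := fps_sqrt_ge0 k0 M0 ME.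
elim=> [|N IH]; first by rewrite /fps_psum big_ord0 ler01.
(* M^2 = X M1 M, whose partial sum only involves shorter ones of M1 and M. *)
pose M1 : fps R := Fps (fun n => fps_coef n.+1 M).
have M1ge : fps_ge0 M1 by move=> n; apply: Mge.
have MX : M = fpsX R * M1.
  by apply: fpsP => -[|n]; rewrite coef_fpsXM.
have E := congr1 (fps_psum N.+1 x) ME; rewrite !fps_psumD in E.
have := k1 N.+1; move: E.
rewrite {3}MX -mulrA fps_psumXM.
have := fps_psumM_le N (ltW x0) M1ge Mge.
rewrite -(ler_pM2l x0) mulrA -(fps_psumXM N x M1) -MX.
have := fps_psum_ge0 N (ltW x0) Mge; have := fps_psum_ge0 N.+1 (ltW x0) Mge.
move: (x * fps_psum N x (M1 * M)) (fps_psum N.+1 x M) (fps_psum N x M) IH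
  (fps_psum N.+1 x k) => y s' s s1 kk s'0 s0 ys E kk1.
by nra.
Qed.

End PartialSums.

(** * Convolutions and subexponential weights *)

Section Weights.
Variable R : realType.
Implicit Types (a b : fps R) (w : nat -> R).

Local Open Scope classical_set_scope.

Lemma series_fps_psum a n :
  series (fun n => fps_coef n a) n = fps_psum n 1 a.
Proof.
rewrite /series /fps_psum -(big_mkord xpredT (fun i => fps_coef i a * 1 ^+ i)).
by apply: eq_bigr => i _; rewrite expr1n mulr1.
Qed.

(** Tannery's theorem: a sum dominated by a convergent series can be passed to
    the limit termwise. *)
Lemma tannery (t : nat -> nat -> R) (l D : nat -> R) (L : R) :
  (forall n k, (k <= n)%N -> `|t n k| <= D k) ->
  (forall k, t n k @[n --> \oo] --> l k) ->
  cvgn (series D) -> series l @ \oo --> L ->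
  \sum_(k < n.+1) t n k @[n --> \oo] --> L.
Proof.
move=> tD tl cD lL.
have D0 k : 0 <= D k by apply: le_trans (tD k k _).
have ndD : nondecreasing_seq (series D).
  by apply: nondecreasing_series => n _ _; apply: D0.
apply/cvgrPdist_le => e e0.
have e3 : 0 < e / 3 by rewrite divr_gt0.
have /cvgrPdist_le/(_ _ e3) nD : series D @ \oo --> limn (series D) by [].
have /cvgrPdist_le/(_ _ e3) nl := lL.
have [m /= [mD ml]] : exists m, `|limn (series D) - series D m| <= e / 3 /\
    `|L - series l m| <= e / 3.
  have [m _ /(_ m (leqnn m))] : \forall m \near \oo,
     `|limn (series D) - series D m| <= e / 3 /\ `|L - series l m| <= e / 3.
    by near=> m; split; near: m.
  by move=> H; exists m.
have tm : \sum_(k < m) t n k @[n --> \oo] --> \sum_(k < m) l k.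
  by apply: cvg_big => [|k _]; [exact: add_continuous|exact: tl].
have /cvgrPdist_le/(_ _ e3) nt := tm.
near=> n.
have mn : (m <= n.+1)%N by apply: leqW; near: n; apply: nbhs_infty_ge.
have h1 : `|\sum_(k < m) l k - \sum_(k < m) t n k| <= e / 3 by near: n.
have -> : \sum_(k < n.+1) t n k = \sum_(k < m) t n k + \sum_(m <= k < n.+1) t n k.
  by rewrite -!(big_mkord xpredT) (big_cat_nat (leq0n m) mn).
have h2 : `|\sum_(m <= k < n.+1) t n k| <= e / 3.
  apply: le_trans (ler_norm_sum _ _ _) _.
  apply: (@le_trans _ _ (\sum_(m <= k < n.+1) D k)).
    by apply: ler_sum_nat => k /andP[_ kn]; apply: tD.
  rewrite -sub_series_geq // ; apply: le_trans mD; apply: le_trans (ler_norm _).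
  by rewrite lerD2r; apply: nondecreasing_cvgn_le.
move: ml h1 h2; rewrite -[series l m]/(\sum_(0 <= k < m) l k) big_mkord.
move: (\sum_(k < m) l k) (\sum_(k < m) _) (\sum_(m <= k < _) _) => x y z.
rewrite !ler_norml => /andP[? ?] /andP[? ?] /andP[? ?]; apply/andP; split; lra.
Unshelve. all: end_near.
Qed.

Lemma cvg_series_sqr_geometric (q : R) : 0 <= q < 1 ->
  cvgn (series (fun k => k.+1%:R ^+ 2 * q ^+ k)).
Proof.
move=> /andP[q0 q1].
apply: nondecreasing_is_cvgn.
  apply: nondecreasing_series => n _ _.
  by rewrite mulr_ge0 ?exprn_ge0.
(* The tail from k on of the series is a quadratic polynomial in k times q^k. *)
pose A := (1 - q)^-1; pose B := (2 + 2 * q * A) * A; pose C := (1 + q * A + q * B) * A.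
have A0 : 0 <= A by rewrite invr_ge0; lra.
have B0 : 0 <= B by rewrite !(mulr_ge0, addr_ge0).
have C0 : 0 <= C by rewrite !(mulr_ge0, addr_ge0).
pose P (k : nat) : R := A * k%:R ^+ 2 + B * k%:R + C.
have P0 k : 0 <= P k by rewrite !(addr_ge0, mulr_ge0, exprn_ge0, ler0n).
exists (P 0%N) => _ [n _ <-].
suff -> : series (fun k => k.+1%:R ^+ 2 * q ^+ k) n = P 0%N - P n * q ^+ n.
  by rewrite gerBl mulr_ge0 // exprn_ge0.
elim: n => [|n IH]; first by rewrite /series /= big_geq // expr0 mulr1 subrr.
rewrite seriesSr IH /P /C /B /A [q ^+ n.+1]exprSr -[n.+1%:R]natr1.
by field; lra.
Qed.

(** A weight is a positive nonincreasing sequence that is asymptotically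
    invariant by translation and decreases at most polynomially. *)
Record weight w : Prop := Weight {
  weight_gt0 : forall n, 0 < w n;
  weight_le : forall n, w n.+1 <= w n;
  weight_ratio : w n / w n.+1 @[n --> \oo] --> (1 : R);
  weight_dom : forall n k, (k <= n)%N -> w (n - k)%N <= k.+1%:R ^+ 2 * w n }.

Lemma weight1 : weight (fun=> 1).
Proof.
split=> // [|n k _]; last by rewrite mulr1 exprn_ege1 // ler1n.
by rewrite divr1; apply: cvg_cst.
Qed.

Lemma cvg_eventually_eq (f g : nat -> R) (m : nat) (l : R) :
  (forall n, (m <= n)%N -> f n = g n) -> f @ \oo --> l -> g @ \oo --> l.
Proof.
move=> fg; apply: cvg_trans; apply: near_eq_cvg.
by exists m => // n /= mn; rewrite fg.
Qed.

Lemma cvg_addn (f : nat -> R) (k : nat) (l : R) :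
  f @ \oo --> l -> f (n + k)%N @[n --> \oo] --> l.
Proof. by rewrite -(cvg_shiftn k). Qed.

Lemma weight_shift w k : weight w -> w n / w (n + k)%N @[n --> \oo] --> (1 : R).
Proof.
move=> ww; elim: k => [|k IH].
  apply: (cvg_eventually_eq (m := 0%N) _ (cvg_cst (1 : R))) => n _.
  by rewrite addn0 divff // gt_eqF // weight_gt0.
pose proof (cvgM IH (cvg_addn k (weight_ratio ww))) as H; rewrite mulr1 in H.
apply: (cvg_eventually_eq (m := 0%N) _ H) => n _.
by rewrite /= addnS mulrA divfK // gt_eqF // weight_gt0.
Qed.

Lemma weight_sub w k : weight w -> w (n - k)%N / w n @[n --> \oo] --> (1 : R).
Proof.
move=> ww; rewrite -(cvg_shiftn k).
by apply: (cvg_eventually_eq (m := 0%N) _ (weight_shift k ww)) => n _; rewrite /= addnK.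
Qed.

Lemma le_weight w m n : weight w -> (m <= n)%N -> w n <= w m.
Proof.
move=> ww; elim: n => [|n IH]; first by rewrite leqn0 => /eqP->.
rewrite leq_eqVlt => /predU1P[->//|mn].
by apply: le_trans (weight_le ww n) _; apply: IH.
Qed.

Lemma cvg_weight_bounded w (a : nat -> R) (l : R) : weight w ->
  a n / w n @[n --> \oo] --> l -> exists2 A, 0 <= A & forall n, `|a n| <= A * w n.
Proof.
move=> ww al.
have /cvg_seq_bounded/ex_bound : cvgn (fun n => a n / w n) by apply/cvg_ex; exists l.
case=> [|A Ab]; first exact: (globally_properfilter (a := 0%N)).
exists A => [|n]; first exact: le_trans (normr_ge0 _) (Ab 0%N I).
have /= := Ab n I; rewrite normrM [`|(w n)^-1|]gtr0_norm ?invr_gt0 ?weight_gt0 //.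
by rewrite ler_pdivrMr // weight_gt0.
Qed.

(** Convolution with a geometrically decreasing sequence multiplies the
    asymptotics with respect to a weight by the sum of that sequence. *)
Lemma cvg_conv w a b (q K l B : R) : weight w -> 0 <= q < 1 ->
  (forall n, `|fps_coef n b| <= K * q ^+ n) ->
  series (fun n => fps_coef n b) @ \oo --> B ->
  fps_coef n a / w n @[n --> \oo] --> l ->
  fps_coef n (a * b) / w n @[n --> \oo] --> l * B.
Proof.
move=> ww q01 bK bB al.
have [A A0 aA] := cvg_weight_bounded ww al.
have K0 : 0 <= K.
  by have := bK 0%N; rewrite expr0 mulr1; apply: le_trans.
pose t n k := fps_coef k b * (fps_coef (n - k) a / w n).
apply: (@cvg_eventually_eq (fun n => \sum_(k < n.+1) t n k) _ 0) => [n _|].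
  by rewrite mulrC [a * b]mulrC coef_fpsM mulr_sumr; apply: eq_bigr => k _; rewrite /t; ring.
apply: (@tannery t (fun k => fps_coef k b * l) (fun k => K * A * (k.+1%:R ^+ 2 * q ^+ k))).
- move=> n k kn; rewrite /t normrM.
  have -> : K * A * (k.+1%:R ^+ 2 * q ^+ k) = (K * q ^+ k) * (A * k.+1%:R ^+ 2) by ring.
  apply: ler_pM => //; rewrite normrM [`|(w n)^-1|]gtr0_norm ?invr_gt0 ?weight_gt0 //.
  rewrite ler_pdivrMr ?weight_gt0 //; apply: le_trans (aA _) _.
  by rewrite -mulrA ler_wpM2l // weight_dom.
- move=> k; apply: cvgMl_tmp.
  have al' : fps_coef (n - k) a / w (n - k)%N @[n --> \oo] --> l.
    by rewrite -(cvg_centern k) in al.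
  pose proof (cvgM al' (weight_sub k ww)) as H; rewrite mulr1 in H.
  apply: (cvg_eventually_eq (m := 0%N) _ H) => n _.
  by rewrite /= mulrA divfK // gt_eqF // weight_gt0.
- exact: (@is_cvg_seriesZ _ (fun k => k.+1%:R ^+ 2 * q ^+ k) (K * A)
    (cvg_series_sqr_geometric q01)).
- pose proof (@cvgMr_tmp _ _ _ _ _ _ l bB) as H; rewrite mulrC.
  apply: (cvg_eventually_eq (m := 0%N) _ H) => n _.
  by rewrite /series /= mulr_suml.
Qed.

(** The sum at 1 of the square of a geometrically decreasing series. *)
Lemma cvg_series_sqr b (q K B : R) : 0 <= q < 1 ->
  (forall n, `|fps_coef n b| <= K * q ^+ n) ->
  series (fun n => fps_coef n b) @ \oo --> B ->
  series (fun n => fps_coef n (b * b)) @ \oo --> B ^+ 2.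
Proof.
have psumE c n : fps_coef n (fps_geom 1 * c) = series (fun n => fps_coef n c) n.+1.
  rewrite mulrC coef_fpsM /series /= big_mkord; apply: eq_bigr => i _.
  by rewrite expr1n mulr1.
move=> q01 bK bB.
rewrite -(cvg_shiftn 1).
have al : fps_coef n (fps_geom 1 * b) / 1 @[n --> \oo] --> B.
  apply: (cvg_eventually_eq (m := 0%N) _ (cvg_addn 1 bB)) => n _.
  by rewrite divr1 psumE addn1.
apply: (cvg_eventually_eq (m := 0%N) _ (cvg_conv weight1 q01 bK bB al)) => n _.
by rewrite divr1 -mulrA psumE -addn1.
Qed.

(** Division by [1 - u X] for [u > 1]: if the quotient is bounded, its
    coefficients are the tails of the numerator. *)
Lemma cvg_div_gt1 w (c N : fps R) (u K l : R) : weight w -> 1 < u ->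
  (forall n, `|fps_coef n c| <= K) ->
  (1 - fps_const u * fpsX R) * c = N ->
  fps_coef n N / w n @[n --> \oo] --> l ->
  fps_coef n c / w n @[n --> \oo] --> - (l / (u - 1)).
Proof.
move=> ww u1 cK cN Nl.
have u0 : 0 < u by lra.
have [A A0 NA] := cvg_weight_bounded ww Nl.
pose th := u^-1.
have th0 : 0 < th by rewrite invr_gt0.
have th1 : th < 1 by rewrite invf_lt1.
have thN : `|th| < 1 by rewrite gtr0_norm.
have K0 : 0 <= K := le_trans (normr_ge0 _) (cK 0%N).
have rec n : fps_coef n c = th * (fps_coef n.+1 c - fps_coef n.+1 N).
  have := congr1 (fps_coef n.+1) cN; rewrite mulrBl mul1r -mulrA coef_fpsB.
  by rewrite coef_fpsCM coef_fpsXM => <-; rewrite /th; field; rewrite gt_eqF.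
have cE n m : fps_coef n c = th ^+ m * fps_coef (n + m) c
    - \sum_(j < m) th ^+ j.+1 * fps_coef (n + j.+1) N.
  elim: m => [|m IH]; first by rewrite big_ord0 addn0 subr0 mul1r.
  by rewrite IH big_ord_recr /= rec addnS exprSr; ring.
pose t n j := th ^+ j.+1 * (fps_coef (n + j.+1) N / w n).
have tl : \sum_(j < n.+1) t n j @[n --> \oo] --> l / (u - 1).
  apply: (@tannery t (fun j => th ^+ j.+1 * l) (fun j => A * (th * th ^+ j))).
  - move=> n j _; rewrite /t normrM -exprS mulrC.
    have thj : 0 <= th ^+ j.+1 by rewrite exprn_ge0 // ltW.
    rewrite (ger0_norm thj) ler_wpM2r //.
    rewrite normrM [`|(w n)^-1|]gtr0_norm ?invr_gt0 ?weight_gt0 //.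
    rewrite ler_pdivrMr ?weight_gt0 //; apply: le_trans (NA _) _.
    by rewrite ler_wpM2l // le_weight // leq_addr.
  - move=> j; apply: cvgMl_tmp.
    have wi : w (n + j.+1)%N / w n @[n --> \oo] --> (1 : R).
      pose proof (cvgV (oner_neq0 R) (weight_shift j.+1 ww)) as H; rewrite invr1 in H.
      by apply: (cvg_eventually_eq (m := 0%N) _ H) => n _; rewrite /= invf_div.
    pose proof (cvgM (cvg_addn j.+1 Nl) wi) as H; rewrite mulr1 in H.
    apply: (cvg_eventually_eq (m := 0%N) _ H) => n _.
    by rewrite /= mulrA divfK // gt_eqF // weight_gt0.
  - have := @is_cvg_geometric_series R (A * th) th thN.
    congr (cvgn (series _)); apply/funext => j; by rewrite /geometric /= mulrA.
  - pose proof (@cvgMr_tmp _ _ _ _ _ _ l (@cvg_geometric_series R th th thN)) as H; move: H.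
    have -> : th / (1 - th) * l = l / (u - 1).
      by rewrite /th; field; apply/andP; split; lra.
    move=> H; apply: (cvg_eventually_eq (m := 0%N) _ H) => n _.
    by rewrite /series /= mulr_suml; apply: eq_bigr => j _; rewrite exprS.
have rem : th ^+ n.+1 * fps_coef (n + n.+1) c / w n @[n --> \oo] --> (0 : R).
  have th01 : 0 <= th < 1 by rewrite ltW.
  have z := cvg_series_cvg_0 (cvg_series_sqr_geometric th01).
  pose proof (@cvgMl_tmp _ _ _ _ _ (th * K / w 0%N) _ z) as z'; rewrite mulr0 in z'.
  pose proof (cvgN z') as z''; rewrite oppr0 in z''.
  apply: (squeeze_cvgr _ z'' z'); near=> n.
  have thn : 0 <= th ^+ n.+1 by rewrite exprn_ge0 // ltW.
  rewrite -ler_norml !normrM (ger0_norm thn).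
  rewrite [`|(w n)^-1|]gtr0_norm ?invr_gt0 ?weight_gt0 //.
  have w0 := weight_gt0 ww 0%N; have wn := weight_gt0 ww n.
  have wb : (w n)^-1 <= n.+1%:R ^+ 2 / w 0%N.
    rewrite ler_pdivlMr // ler_pdivrMl // mulrC.
    by have := weight_dom ww (leqnn n); rewrite subnn.
  have -> : th * K / w 0%N * (n.+1%:R ^+ 2 * th ^+ n)
     = th ^+ n.+1 * K * (n.+1%:R ^+ 2 / w 0%N) by rewrite [th ^+ n.+1]exprS; ring.
  apply: ler_pM => //; first by rewrite mulr_ge0 // exprn_ge0 // ltW.
    by rewrite invr_ge0 ltW.
  by rewrite ler_wpM2l // exprn_ge0 // ltW.
pose proof (cvgB rem tl) as H; rewrite sub0r in H.
apply: (cvg_eventually_eq (m := 0%N) _ H) => n _.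
rewrite [in RHS](cE n n.+1) mulrBl /=; congr (_ - _).
by rewrite mulr_suml; apply: eq_bigr => j _; rewrite /t mulrA.
Unshelve. all: end_near.
Qed.

End Weights.

(** * Central binomial coefficients and Wallis' product *)

Section Wallis.
Variable R : realType.

(** Primitives of the powers of the sine, given by the reduction formula. *)
Fixpoint sin_prim (n : nat) (x : R) : R :=
  match n with
  | 0 => x
  | 1 => 1 - cos x
  | (n'.+1 as m).+1 => (m%:R * sin_prim n' x - sin x ^+ m * cos x) / m.+1%:R
  end.

Lemma nat_ind2 (P : nat -> Prop) :
  P 0%N -> P 1%N -> (forall n, P n -> P n.+2) -> forall n, P n.
Proof.
move=> P0 P1 PSS n; suff [] : P n /\ P n.+1 by [].
by elim: n => [|n [Pn PSn]]; split=> //; apply: PSS.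
Qed.

Lemma is_derive_sin_prim n (x : R) : is_derive x 1 (sin_prim n) (sin x ^+ n).
Proof.
elim/nat_ind2: n => [||n IH].
- by rewrite expr0; apply: is_derive_id.
- have -> : sin_prim 1 = cst 1 - cos by [].
  by apply: is_derive_eq; rewrite expr1 sub0r opprK.
have -> : sin_prim n.+2 = (n.+2%:R)^-1 *: (n.+1%:R *: sin_prim n - (@sin R ^+ n.+1) * cos).
  by apply/funext => y; rewrite /= !fctE /= mulrC.
apply: is_derive_eq.
rewrite /= exprfctE /GRing.scale /=.
have c2 := cos2sin2 x.
have n2 : (n.+2%:R : R) != 0 by rewrite pnatr_eq0.
apply: (mulfI n2); rewrite mulVKf //.
rewrite -[n.+2%:R]natr1 !exprS.
apply/eqP; rewrite -subr_eq0; apply/eqP.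
transitivity (n.+1%:R * sin x ^+ n * (1 - sin x ^+ 2 - cos x ^+ 2)); first by ring.
by rewrite c2 subrr mulr0.
Qed.

(** The Wallis integral of the n-th power of the sine on [0, pi/2]. *)
Definition wallis (n : nat) : R := sin_prim n (pi / 2).

Lemma sin_prim0 n : sin_prim n 0 = 0.
Proof.
elim/nat_ind2: n => [||n IH] //=; first by rewrite cos0 subrr.
by rewrite IH sin0 expr0n /= mul0r mulr0 subrr mul0r.
Qed.

Lemma wallisSS n : wallis n.+2 = n.+1%:R / n.+2%:R * wallis n.
Proof. by rewrite /wallis /= cos_pihalf mulr0 subr0 mulrAC. Qed.

Lemma wallisS_le n : wallis n.+1 <= wallis n.
Proof.
have der (x : R) : is_derive x 1 (sin_prim n - sin_prim n.+1)
    (sin x ^+ n - sin x ^+ n.+1).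
  by apply: is_deriveB; apply: is_derive_sin_prim.
have [||x] := @MVT_segment R _ _ 0 (pi / 2) _ (fun x _ => der x).
- by rewrite divr_ge0 // pi_ge0.
- apply: continuous_subspaceT => x.
  by apply/differentiable_continuous/derivable1_diffP; have [] := der x.
rewrite in_itv => /andP[/= x0 xpi].
rewrite -[LHS]/((sin_prim n (pi / 2) - sin_prim n.+1 (pi / 2))
  - (sin_prim n 0 - sin_prim n.+1 0)) !sin_prim0 !subr0 => E.
rewrite -subr_ge0 /wallis E mulr_ge0 ?divr_ge0 ?pi_ge0 //.
rewrite exprS -[X in X - _]mul1r -mulrBl mulr_ge0 ?subr_ge0 ?sin_le1 //.
rewrite exprn_ge0 // sin_ge0_pi // x0 (le_trans xpi) //.
by have := pi_ge0 R; lra.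
Qed.

(** [cbin n] is the central binomial coefficient divided by 4^n. *)
Fixpoint cbin (n : nat) : R :=
  if n is m.+1 then cbin m * ((m.*2.+1)%:R / (m.*2.+2)%:R) else 1.

Lemma cbin_gt0 n : 0 < cbin n.
Proof. by elim: n => //= n IH; rewrite mulr_gt0 // divr_gt0. Qed.

Lemma wallis_even n : wallis n.*2 = pi / 2 * cbin n.
Proof.
elim: n => [|n IH]; first by rewrite mulr1.
by rewrite doubleS wallisSS IH /=; ring.
Qed.

Lemma wallis_odd n : wallis n.*2.+1 * (n.*2.+1%:R * cbin n) = 1.
Proof.
elim: n => [|n IH].
  by rewrite /wallis /= cos_pihalf subr0 !mulr1.
rewrite doubleS wallisSS /= -[RHS]IH.


by field; rewrite -!natrD !pnatr_eq0.
Qed.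

(** Consecutive Wallis integrals are compared by monotonicity. *)
Lemma cbin_sqr_bounds n :
  1 <= cbin n ^+ 2 * (n.*2.+1%:R * (pi / 2)) <= n.*2.+2%:R / n.*2.+1%:R.
Proof.
have n1 : (0 < n.*2.+1%:R :> R) by [].
have n2 : (0 < n.*2.+2%:R :> R) by [].
have b0 := cbin_gt0 n.
have o := wallis_odd n.
have o0 : 0 < n.*2.+1%:R * cbin n by rewrite mulr_gt0.
apply/andP; split.
  rewrite -[leLHS]o; have := wallisS_le n.*2; rewrite wallis_even => h.
  by apply: le_trans (ler_wpM2r (ltW o0) h) _; rewrite le_eqVlt; apply/orP; left; apply/eqP; ring.
have := wallisS_le n.*2.+1; rewrite -doubleS wallis_even /= => h.
have := ler_wpM2r (ltW (mulr_gt0 o0 n2)) h; rewrite (mulrA (wallis _)) o mul1r.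
rewrite ler_pdivlMr //; apply: le_trans.
rewrite le_eqVlt; apply/orP; left; apply/eqP; field.
by rewrite -natrD pnatr_eq0.
Qed.

Local Open Scope classical_set_scope.

Lemma cbin_sqr_cvg : cbin n ^+ 2 * (n%:R * pi) @[n --> \oo] --> (1 : R).
Proof.
have h0 := @cvg_harmonic R.
apply: (@squeeze_cvgr _ _ _ _ (fun n => 1 - harmonic n) (fun n => 1 + harmonic n)).
- near=> n.
  have n1 : (0 < n.*2.+1%:R :> R) by [].
  have /andP[lo up] := cbin_sqr_bounds n.
  have -> : cbin n ^+ 2 * (n%:R * pi) =
      cbin n ^+ 2 * (n.*2.+1%:R * (pi / 2)) * (n.*2%:R / n.*2.+1%:R).
    by rewrite -mul2n natrM; field; apply: lt0r_neq0; have := ler0n R n; lra.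
  have h : (n.*2.+1%:R : R)^-1 <= harmonic n.
    by rewrite /harmonic lef_pV2 ?posrE ?ltr0n // ler_nat; lia.
  have qE : n.*2%:R / n.*2.+1%:R = 1 - (n.*2.+1%:R : R)^-1.
    by rewrite -natr1; field; apply: lt0r_neq0; have := ler0n R n.*2; lra.
  have rE : n.*2.+2%:R / n.*2.+1%:R = 1 + (n.*2.+1%:R : R)^-1.
    by rewrite -natr1; field; apply: lt0r_neq0; have := ler0n R n.*2; lra.
  rewrite {}rE in up; rewrite {}qE.
  have i0 : 0 < (n.*2.+1%:R : R)^-1 by rewrite invr_gt0.
  have i1 : (n.*2.+1%:R : R)^-1 <= 1 by rewrite invf_le1 // ler1n.
  move: (_^-1) (cbin n ^+ 2 * _) h i0 i1 lo up => i c h i0 i1 lo up.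
  by apply/andP; split; nra.
- by rewrite -[X in _ --> X]subr0; apply: cvgB => //; apply: cvg_cst.
- by rewrite -[X in _ --> X]addr0; apply: cvgD => //; apply: cvg_cst.
Unshelve. all: end_near.
Qed.

End Wallis.

(** * The Catalan weight and the square root of 1 - X *)

Section CatalanWeight.
Variable R : realType.
Local Open Scope classical_set_scope.

(** The Catalan numbers divided by 4^n. *)
Definition catw (n : nat) : R := cbin R n / n.+1%:R.

Lemma catw_gt0 n : 0 < catw n.
Proof. by rewrite divr_gt0 // cbin_gt0. Qed.

Lemma catwS n : catw n.+1 = catw n * ((2 * n%:R + 1) / (2 * n%:R + 4)).
Proof.
rewrite /catw /= -mul2n -!natr1 !natrM.
have := ler0n R n; move: (n%:R : R) => x x0.
by field; apply/andP; split; lra.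
Qed.

(** The weight decreases at most quadratically. *)
Lemma catw_sqr_le m n : (m <= n)%N ->
  catw m * m.+1%:R ^+ 2 <= catw n * n.+1%:R ^+ 2.
Proof.
elim: n => [|n IH]; first by rewrite leqn0 => /eqP->.
rewrite leq_eqVlt => /predU1P[->//|/IH/le_trans]; apply.
rewrite catwS -!natr1 -mulrA ler_pM2l ?catw_gt0 //.
have := ler0n R n; move: (n%:R : R) => x x0.
by rewrite mulrAC ler_pdivlMr; [nra|lra].
Qed.

Lemma weight_catw : weight catw.
Proof.
split=> [|n||n k kn]; first exact: catw_gt0.
- rewrite catwS ler_piMr ?(ltW (catw_gt0 n)) //.
  have n0 := ler0n R n; rewrite ler_pdivrMr; lra.
- have h0 := @cvg_harmonic R.
  pose proof (cvgD (cvg_cst (1 : R)) (@cvgMl_tmp _ _ _ _ _ 3 _ h0)) as h1.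
  rewrite mulr0 addr0 in h1.
  apply: (squeeze_cvgr _ (cvg_cst (1 : R)) h1); near=> n.
  have wn := catw_gt0 n; have n0 := ler0n R n.
  have -> : catw n / catw n.+1 = 1 + 3 / (2 * n%:R + 1).
    by rewrite catwS; field; rewrite !lt0r_neq0 //; lra.
  rewrite lerDl lerD2l divr_ge0 /=; [|lra|lra].
  rewrite ler_pM2l // /harmonic lef_pV2 ?posrE -?natr1; lra.
have a0 : 0 < (n - k).+1%:R :> R by [].
rewrite -(ler_pM2r (exprn_gt0 2 a0)).
apply: le_trans (catw_sqr_le (leq_subr k n)) _.
rewrite [leRHS]mulrAC [leRHS]mulrC ler_pM2l ?catw_gt0 // -exprMn.
rewrite ler_sqr ?nnegrE // -natrM ler_nat; nia.
Unshelve. all: end_near.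
Qed.

Lemma catw_cvg : catw n * Num.sqrt (n%:R ^+ 3 * pi) @[n --> \oo] --> (1 : R).
Proof.
have h0 := @cvg_harmonic R.
pose proof (cvgB (cvg_cst (1 : R)) h0) as h1; rewrite subr0 in h1.
pose proof (cvg_comp _ _ (@cbin_sqr_cvg R) (@sqrt_continuous R 1)) as h2.
rewrite sqrtr1 in h2.
pose proof (cvgM h2 h1) as h3; rewrite mulr1 in h3.
apply: (cvg_eventually_eq (m := 0%N) _ h3) => n _ /=.
have p0 := pi_ge0 R; have n0 := ler0n R n; have b0 := cbin_gt0 R n.
rewrite sqrtrM ?sqr_ge0 // sqrtr_sqr gtr0_norm //.
have -> : n%:R ^+ 3 * pi = n%:R ^+ 2 * (n%:R * pi) :> R by ring.
rewrite [X in _ = _ * X]sqrtrM ?sqr_ge0 // sqrtr_sqr ger0_norm //.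
rewrite -[((fun=> 1) - harmonic) n]/(1 - n.+1%:R^-1) /catw -natr1.
by field; lra.
Qed.

(** The power series of the square root of [1 - X]. *)
Definition sqrt1X : fps R := 1 - fps_const 2^-1 * (fpsX R * Fps catw).

Lemma coef_sqrt1X n :
  fps_coef n sqrt1X = if n is m.+1 then - (2^-1 * catw m) else 1.
Proof.
rewrite coef_fpsB coef_fpsCM coef_fpsXM coef_fps1.
by case: n => [|n]; rewrite ?mulr0 ?subr0 //= sub0r.
Qed.

Lemma catw0 : catw 0 = 1.
Proof. by rewrite /catw /= divr1. Qed.

(** Both sides satisfy the differential equation [(1 - X) H' = - H] and have
    constant term 1. *)
Lemma sqrt1X_sqr : sqrt1X * sqrt1X = 1 - fpsX R.
Proof.
have ode : (1 - fpsX R) * (fps_deriv sqrt1X + fps_deriv sqrt1X) = - sqrt1X.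
  apply: fpsP => n; rewrite mulrBl mul1r coef_fpsB coef_fpsXM coef_fpsN.
  case: n => [|n]; rewrite !(coef_fpsD (fps_deriv _)) !coef_fps_deriv
      !coef_sqrt1X; first by rewrite catw0; field.
  rewrite catwS -!natr1; have := ler0n R n.
  by move: (n%:R : R) => x x0; field; lra.
set H := sqrt1X * sqrt1X.
have odeH : (1 - fpsX R) * fps_deriv H = - H.
  rewrite fps_derivM /H -mulNr -ode; ring.
have H0 : fps_coef 0 H = 1.
  by rewrite coef_fpsM big_ord1 subn0 coef_sqrt1X mulr1.
have rec n : n.+1%:R * fps_coef n.+1 H = (n%:R - 1) * fps_coef n H.
  have := congr1 (fps_coef n) odeH.
  rewrite mulrBl mul1r coef_fpsB coef_fpsXM coef_fpsN.
  by case: n => [|n]; rewrite !coef_fps_deriv; lra.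
have H1 : fps_coef 1 H = -1 by have := rec 0%N; rewrite H0; lra.
have HSS n : fps_coef n.+2 H = 0.
  elim: n => [|n IH]; apply/eqP.
    by have := rec 1%N; rewrite subrr mul0r => /eqP; rewrite mulf_eq0 pnatr_eq0.
  by have := rec n.+2; rewrite IH mulr0 => /eqP; rewrite mulf_eq0 pnatr_eq0.
apply: fpsP => -[|[|n]]; rewrite coef_fpsB coef_fps1 ?H0 ?H1 ?HSS /=; lra.
Qed.

Lemma coef_sqrt1X_cvg :
  fps_coef n sqrt1X / catw n @[n --> \oo] --> (- 2^-1 : R).
Proof.
rewrite -(cvg_shiftn 1).
pose proof (@cvgMl_tmp _ _ _ _ _ (- 2^-1) _ (weight_ratio weight_catw)) as h.
rewrite mulr1 in h.
apply: (cvg_eventually_eq (m := 0%N) _ h) => n _.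
by rewrite -[RHS]/(fps_coef (n + 1) sqrt1X / catw (n + 1)) addn1 coef_sqrt1X mulNr mulrA mulNr.
Qed.

End CatalanWeight.

(** * The generating functions at the dominant singularity *)

Section Growth.
Variables (R : realType) (r : R).
Hypotheses (r_gt0 : 0 < r) (r_le : r <= 3 / 10)
  (rE : 4 * r = 1 + 2 * r ^+ 2 + r ^+ 4).
Local Open Scope classical_set_scope.

Let r_gt14 : 1 / 4 < r.
Proof.
by have := exprn_gt0 2 r_gt0; have := exprn_gt0 4 r_gt0; have := rE; lra.
Qed.

Let r_cubic : r ^+ 3 + r ^+ 2 + 3 * r = 1.
Proof.
have /eqP : (r - 1) * (r ^+ 3 + r ^+ 2 + 3 * r - 1) = 0.
  by transitivity (1 + 2 * r ^+ 2 + r ^+ 4 - 4 * r); [ring|rewrite rE subrr].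
rewrite mulf_eq0 => /orP[/eqP|/eqP]; first by have := r_le; lra.
by lra.
Qed.

(* The original variable x, in terms of the rescaled one. *)
Let cX : fps R := fps_const r * fpsX R.

(** The generating functions of the (-1)-Dyck paths, of the grounded ones and
    of the nonempty (-1)-Dyck paths, in the rescaled variable [X = x / r]. *)
Definition dyckF : fps R := Fps (fun n => (ntrees good n)%:R * r ^+ n).
Definition dyckQ : fps R := Fps (fun n => (ntrees ground n)%:R * r ^+ n).
Definition dyckf : fps R := dyckF - 1.

Let coef_cXM a n : fps_coef n.+1 (cX * a) = r * fps_coef n a.
Proof. by rewrite -mulrA coef_fpsCM coef_fpsXM. Qed.

(** The convolutions in the recurrences leave out the empty right factor, which
    amounts to subtracting 1 from its series. *)
Lemma coef_conv_sub1 (A B : nat -> nat) n : B 0%N = 1%N ->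
  fps_coef n (Fps (fun n => (A n)%:R * r ^+ n) * (Fps (fun n => (B n)%:R * r ^+ n) - 1))
  = (\sum_(k < n) A k * B (n - k))%N%:R * r ^+ n.
Proof.
move=> B0; set b := (X in _ * X).
have b0 : fps_coef 0 b = 0.
  by rewrite coef_fpsB coef_fps1 /= B0 mulr1 subrr.
have bS m : (0 < m)%N -> fps_coef m b = (B m)%:R * r ^+ m.
  by case: m => // m _; rewrite coef_fpsB coef_fps1 subr0.
move: b b0 bS => b b0 bS.
rewrite coef_fpsM big_ord_recr /= subnn b0 mulr0 addr0.
rewrite natr_sum mulr_suml; apply: eq_bigr => k _; have kn := ltn_ord k.
have -> : r ^+ n = r ^+ k * r ^+ (n - k) by rewrite -exprD subnKC // ltnW.
by rewrite bS ?subn_gt0 // natrM; ring.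
Qed.

Lemma dyckF_eq : dyckF = 1 + cX * (dyckF + dyckQ * (dyckF - 1)).
Proof.
apply: fpsP => -[|n].
  by rewrite coef_fpsD -mulrA coef_fpsCM coef_fpsXM mulr0 addr0 /= ntrees0 mulr1.
rewrite coef_fpsD coef_cXM coef_fps1 add0r coef_fpsD coef_conv_sub1 ?ntrees0 //.
by rewrite /= ntrees_good natrD exprS; ring.
Qed.

Lemma dyckQ_eq : dyckQ = fps_geom r + cX * (dyckQ * (dyckQ - 1)).
Proof.
apply: fpsP => -[|n].
  by rewrite coef_fpsD -mulrA coef_fpsCM coef_fpsXM mulr0 addr0 /= ntrees0 mulr1.
rewrite coef_fpsD coef_cXM coef_conv_sub1 ?ntrees0 //.
by rewrite /= ntrees_ground natrD exprS; ring.
Qed.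

Lemma dyckf_eq : dyckf = cX * (1 + dyckf + dyckQ * dyckf).
Proof. by rewrite /dyckf {1}dyckF_eq; ring. Qed.

(** The quadratic equation for [dyckQ], with the geometric series of [dyckQ_eq]
    multiplied out. *)
Lemma dyckQ_quad :
  (1 - cX) * dyckQ = 1 + (1 - cX) * cX * dyckQ * (dyckQ - 1).
Proof. by rewrite {1}dyckQ_eq mulrDr fps_geomE; ring. Qed.

(** The square root in the solution of the quadratic equation for [dyckQ]. *)
Definition dyckD : fps R := 1 - cX ^+ 2 - 2 * cX * (1 - cX) * dyckQ.

Lemma dyckD_sqr : dyckD * dyckD = 1 - 4 * cX + 2 * cX ^+ 2 + cX ^+ 4.
Proof.
apply/eqP; rewrite -subr_eq0; apply/eqP.
transitivity (4 * cX * (1 - cX) *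
  (1 + (1 - cX) * cX * dyckQ * (dyckQ - 1) - (1 - cX) * dyckQ)).
  by rewrite /dyckD; ring.
by rewrite -dyckQ_quad subrr mulr0.
Qed.

(** The numerator of the fraction [2 dyckf = dyckN / (1 - 4x + 2x^2)]. *)
Definition dyckN : fps R := dyckD - (1 - cX) * (1 - 3 * cX).

Let coef0M (a b : fps R) : fps_coef 0 (a * b) = fps_coef 0 a * fps_coef 0 b.
Proof. by rewrite coef_fpsM big_ord1. Qed.

Lemma dyckf_num : 2 * dyckf * (1 - 4 * cX + 2 * cX ^+ 2) = dyckN.
Proof.
apply: fps_mulX_inj.
apply: (@fps_mulI _ (2 * fps_const r * (1 - cX))).
  rewrite !coef0M coef_fpsB coef0M /= mulr0.
  by apply: lt0r_neq0; have := r_gt0; lra.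
transitivity (dyckf * (dyckD * dyckD - ((1 - cX) * (1 - 3 * cX)) ^+ 2)).
  by rewrite dyckD_sqr /cX; ring.
(* Rationalize dyckf = 2 x (1 - x) / ((1 - x) (1 - 3 x) + dyckD); the factor
   2 x (1 - x) has been cancelled above. *)
have fE : dyckf * (1 - cX - cX * dyckQ) = cX.
  by rewrite [X in _ = X](_ : cX = dyckf - cX * (dyckf + dyckQ * dyckf)); [ring|rewrite {1}dyckf_eq; ring].
transitivity (2 * (1 - cX) * (dyckf * (1 - cX - cX * dyckQ)) * dyckN).
  by rewrite /dyckN /dyckD; ring.
by rewrite fE /cX; ring.
Qed.

(** The cofactor of [sqrt1X] in [dyckD], whose coefficients decrease
    geometrically; the inverse of [sqrt1X] is [sqrt1X / (1 - X)]. *)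
Definition dyckT : fps R := dyckD * sqrt1X R * fps_geom 1.

Let geom1E : (1 - fpsX R) * fps_geom 1 = 1.
Proof. by have := fps_geomE (1 : R); rewrite (rmorph1 (@fps_const R)) mul1r. Qed.

Lemma dyckD_factor : dyckD = dyckT * sqrt1X R.
Proof.
transitivity (dyckD * (sqrt1X R * sqrt1X R * fps_geom 1)); last by rewrite /dyckT; ring.
by rewrite sqrt1X_sqr geom1E mulr1.
Qed.

(** The cofactor of [1 - X] in the square of [dyckD] is [1 - dyckk], with
    [dyckk] nonnegative. *)
Definition dyckk : fps R := fpsX R * (fps_const (4 * r - 1)
  + fpsX R * (fps_const (r ^+ 4) + fpsX R * fps_const (r ^+ 4))).

Lemma dyckT_sqr : dyckT * dyckT = 1 - dyckk.
Proof.
transitivity (dyckD * dyckD * (sqrt1X R * sqrt1X R * fps_geom 1) * fps_geom 1).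
  by rewrite /dyckT; ring.
rewrite sqrt1X_sqr geom1E mulr1 dyckD_sqr.
suff -> : 1 - 4 * cX + 2 * cX ^+ 2 + cX ^+ 4 = (1 - fpsX R) * (1 - dyckk).
  by rewrite mulrAC geom1E mul1r.
rewrite /dyckk /cX !(rmorphB, rmorphXn, rmorphM) rmorph1 rmorph_nat.
have cE : 4 * fps_const r = 1 + 2 * fps_const r ^+ 2 + fps_const r ^+ 4.
  have := congr1 (@fps_const R) rE; rewrite !(rmorphD, rmorphXn, rmorphM) !rmorph1 /= => h.
  transitivity ((1 + (1 + (1 + 1))) * fps_const r); first by ring.
  by rewrite h; ring.
have -> : 2 * (fps_const r * fpsX R) ^+ 2
   = (4 * fps_const r - 1 - fps_const r ^+ 4) * fpsX R ^+ 2 by rewrite cE; ring.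
by ring.
Qed.

(** [1 - dyckM] is the square root of [1 - dyckk], hence [dyckM] has
    nonnegative coefficients. *)
Definition dyckM : fps R := 1 - dyckT.

Lemma dyckM_eq : dyckM + dyckM = dyckk + dyckM * dyckM.
Proof.
rewrite /dyckM (_ : _ * _ = 1 - 2 * dyckT + dyckT * dyckT); last by ring.
by rewrite dyckT_sqr; ring.
Qed.

Lemma coef0_dyckM : fps_coef 0 dyckM = 0.
Proof.
have cX0 a : fps_coef 0 (cX * a) = 0 by rewrite coef0M coef0M /= mulr0 !mul0r.
have D0 : fps_coef 0 dyckD = 1.
  rewrite (_ : dyckD = 1 - cX * (cX + 2 * (1 - cX) * dyckQ)); last first.
    by rewrite /dyckD; ring.
  by rewrite coef_fpsB cX0 subr0 coef_fps1.
by rewrite coef_fpsB !coef0M D0 coef_sqrt1X coef_fps1 /= !mulr1 subrr.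
Qed.

Let X_ge0 : fps_ge0 (fpsX R).
Proof. by move=> n; apply: ler0n. Qed.

Let C_ge0 (x : R) : 0 <= x -> fps_ge0 (fps_const x).
Proof. by move=> x0 [|n]. Qed.

Let D_ge0 (a b : fps R) : fps_ge0 a -> fps_ge0 b -> fps_ge0 (a + b).
Proof. by move=> a0 b0 n; rewrite coef_fpsD addr_ge0. Qed.

Lemma dyckk_ge0 : fps_ge0 dyckk.
Proof.
have r4 : 0 <= r ^+ 4 by rewrite exprn_ge0 // ltW.
apply: fps_geM => //; apply: D_ge0; first by apply: C_ge0; have := r_gt14; lra.
apply: fps_geM => //; apply: D_ge0; first exact: C_ge0.
by apply: fps_geM => //; apply: C_ge0.
Qed.

Let psum_dyckk N x : fps_psum N.+4 x dyckk =
  x * (4 * r - 1 + x * (r ^+ 4 + x * r ^+ 4)).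
Proof.
by rewrite /dyckk fps_psumXM fps_psumD fps_psumC fps_psumXM fps_psumD fps_psumC
  fps_psumXM fps_psumC.
Qed.

Let r4_le : r ^+ 4 <= 81 / 10000.
Proof.
have -> : 81 / 10000 = (3 / 10) ^+ 4 :> R by field.
by rewrite lerXn2r ?nnegrE ?(ltW r_gt0) //; lra.
Qed.

Lemma dyckM_ge0 : fps_ge0 dyckM.
Proof. exact: fps_sqrt_ge0 dyckk_ge0 coef0_dyckM dyckM_eq. Qed.

Lemma psum_dyckM N : fps_psum N 2 dyckM <= 1.
Proof.
move: N; apply: (fps_sqrt_psum _ dyckk_ge0 coef0_dyckM dyckM_eq) => // N.
apply: le_trans (le_fps_psum _ dyckk_ge0 (_ : (N <= N.+4)%N)) _ => //.
  by do 4!apply: leqW.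
by rewrite psum_dyckk; have := r_le; have := r4_le; lra.
Qed.

Lemma coef_dyckM_le n : fps_coef n dyckM <= (2^-1) ^+ n.
Proof.
have := psum_dyckM n.+1; rewrite /fps_psum big_ord_recr => h.
have {}h : fps_psum n 2 dyckM + fps_coef n dyckM * 2 ^+ n <= 1 := h.
have := fps_psum_ge0 n (ler0n _ 2) dyckM_ge0.
by rewrite exprVn -[(2 ^+ n)^-1]mul1r ler_pdivlMr ?exprn_gt0 //; lra.
Qed.

Lemma coef_dyckT_le n : `|fps_coef n dyckT| <= 1 * (2^-1) ^+ n.
Proof.
have -> : dyckT = 1 - dyckM by rewrite /dyckM; ring.
rewrite coef_fpsB coef_fps1 mul1r; case: n => [|n].
  by rewrite coef0_dyckM subr0 normr1.
by rewrite sub0r normrN ger0_norm ?coef_dyckM_le // dyckM_ge0.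
Qed.

Let dyckTE : dyckT = fps_const 1 - dyckM.
Proof. by rewrite rmorph1 /dyckM; ring. Qed.

(** The sum of [dyckT] at 1, that is at the dominant singularity. *)
Lemma dyckT_sum : exists2 B, 0 < B /\ B ^+ 2 = 2 - 4 * r - 2 * r ^+ 4 &
  series (fun n => fps_coef n dyckT) @ \oo --> B.
Proof.
pose mM n := fps_coef n dyckM.
have serE n : series mM n = fps_psum n 1 dyckM by apply: series_fps_psum.
have ser1 n : series mM n <= 1.
  rewrite serE; apply: le_trans (psum_dyckM n); apply: ler_sum => i _.
  by rewrite ler_wpM2l ?dyckM_ge0 // expr1n exprn_ege1 // ler1n.
have cM : cvgn (series mM).
  apply: nondecreasing_is_cvgn; last by exists 1 => _ [n _ <-].
  by apply: nondecreasing_series => n _ _; apply: dyckM_ge0.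
have M1 : limn (series mM) <= 1 by apply: limr_le => //; near=> n.
pose B := 1 - limn (series mM).
have TB : series (fun n => fps_coef n dyckT) @ \oo --> B.
  pose proof (cvgB (cvg_cst (1 : R)) cM) as h.
  apply: (cvg_eventually_eq (m := 1%N) _ h) => -[//|n] _.
  rewrite -[LHS]/(1 - series mM n.+1) series_fps_psum serE.
  by rewrite dyckTE (fps_psumD _ _ (fps_const 1) (- dyckM)) fps_psumC (fps_psumN _ _ dyckM).
have B2 : B ^+ 2 = 2 - 4 * r - 2 * r ^+ 4.
  have q01 : 0 <= (2^-1 : R) < 1 by apply/andP; split; lra.
  have h := cvg_series_sqr q01 coef_dyckT_le TB.
  apply: (cvg_unique _ h) => //.
  apply: (cvg_eventually_eq (m := 4%N) _ (cvg_cst (2 - 4 * r - 2 * r ^+ 4))) => -[|[|[|[|n]]]] // _.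
  rewrite series_fps_psum.
  rewrite dyckT_sqr fps_psumD fps_psumN psum_dyckk.
  by rewrite -(rmorph1 (@fps_const R)) fps_psumC; ring.
exists B => //; split=> //.
rewrite lt_neqAle subr_ge0 M1 andbT; apply/eqP => B0.
by move: B2; rewrite -B0; have := r_le; have := r4_le; lra.
Unshelve. all: end_near.
Qed.

Lemma dyckQ_ge0 : fps_ge0 dyckQ.
Proof. by move=> n; rewrite mulr_ge0 // exprn_ge0 // ltW. Qed.

Let sub1_ge0 (A : nat -> nat) : A 0%N = 1%N ->
  fps_ge0 (Fps (fun n => (A n)%:R * r ^+ n) - 1).
Proof.
move=> A0 [|n]; rewrite coef_fpsB coef_fps1 /= ?A0 ?mulr1 ?subrr // subr0.
by rewrite mulr_ge0 // exprn_ge0 // ltW.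
Qed.

Let psum1 N : fps_psum N.+1 1 (1 : fps R) = 1.
Proof. by rewrite -(rmorph1 (@fps_const R)) fps_psumC. Qed.

(** At the singularity the partial sums of [dyckQ] stay below the double root
    of the quadratic equation. *)
Lemma psum_dyckQ N : fps_psum N 1 dyckQ <= (1 + r) / (2 * r).
Proof.
have r0 := r_gt0; have r1 := r_le; have c3 := r_cubic.
set q := (1 + r) / (2 * r).
have q1 : 1 <= q by rewrite /q ler_pdivlMr; lra.
have qE : 1 / (1 - r) + r * (q * (q - 1)) = q.
  apply/eqP; rewrite -subr_eq0; apply/eqP.
  transitivity ((r ^+ 3 + r ^+ 2 + 3 * r - 1) / (4 * r * (1 - r))).
    by rewrite /q; field; apply/andP; split; lra.
  by rewrite c3 subrr mul0r.
elim: N => [|N IH]; first by rewrite /fps_psum big_ord0; lra.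
rewrite {1}dyckQ_eq fps_psumD -mulrA fps_psumCM fps_psumXM mul1r -qE lerD //.
  rewrite ler_pdivlMr ?fps_psum_geom; last lra.
  by rewrite gerBl exprn_ge0 // ltW.
rewrite ler_pM2l //; apply: le_trans (fps_psumM_le _ _ _ _) _ => //.
- exact: dyckQ_ge0.
- by apply: sub1_ge0; rewrite ntrees0.
apply: ler_pM => //.
- by apply: fps_psum_ge0 => //; apply: dyckQ_ge0.
- by apply: fps_psum_ge0 => //; apply: sub1_ge0; rewrite ntrees0.
case: N IH => [|N] IH; first by rewrite /fps_psum big_ord0; lra.
by rewrite fps_psumD fps_psumN psum1; lra.
Qed.

Lemma dyckf_ge0 : fps_ge0 dyckf.
Proof. by apply: sub1_ge0; rewrite ntrees0. Qed.

(** The equation [dyckf = x (1 + dyckf + dyckQ dyckf)] is a renewal equation of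
    mass at most [(1 + 3 r) / 2 < 1] at the singularity. *)
Lemma psum_dyckf N : fps_psum N 1 dyckf <= 2 * r / (1 - 3 * r).
Proof.
have r0 := r_gt0; have r1 := r_le.
set K := 2 * r / (1 - 3 * r); set q := (1 + r) / (2 * r).
have K0 : 0 <= K by rewrite divr_ge0; lra.
have KE : r * (1 + K + q * K) = K.
  by rewrite /K /q; field; apply/andP; split; lra.
elim: N => [|N IH]; first by rewrite /fps_psum big_ord0.
rewrite {1}dyckf_eq -mulrA fps_psumCM fps_psumXM mul1r -[leRHS]KE ler_pM2l //.
rewrite 2!fps_psumD !lerD //.
  by case: N {IH} => [|N]; rewrite ?psum1 // /fps_psum big_ord0.
apply: le_trans (fps_psumM_le _ _ dyckQ_ge0 dyckf_ge0) _ => //.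
apply: ler_pM => //; last exact: psum_dyckQ.
- by apply: fps_psum_ge0 => //; apply: dyckQ_ge0.
- by apply: fps_psum_ge0 => //; apply: dyckf_ge0.
Qed.

Lemma coef_dyckf_le n : fps_coef n dyckf <= 2 * r / (1 - 3 * r).
Proof.
apply: le_trans (psum_dyckf n.+1); rewrite /fps_psum big_ord_recr expr1n mulr1.
by rewrite lerDr; apply: (fps_psum_ge0 n ler01 dyckf_ge0).
Qed.

(** The coefficients of [dyckf] are asymptotic to a multiple of the Catalan
    weight. *)
Lemma dyckf_cvg : exists2 B : R, 0 < B /\ B ^+ 2 = 2 - 4 * r - 2 * r ^+ 4 &
  fps_coef n dyckf / catw R n @[n --> \oo] --> B / (4 * r ^+ 4).
Proof.
have r0 := r_gt0; have r1 := r_le; have r14 := r_gt14; have qE := rE.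
have r4 : 0 < r ^+ 4 by rewrite exprn_gt0.
have [B [B0 B2] TB] := dyckT_sum.
exists B => //.
have half01 : 0 <= (2^-1 : R) < 1 by apply/andP; split; lra.
have Dl : fps_coef n dyckD / catw R n @[n --> \oo] --> - 2^-1 * B.
  rewrite dyckD_factor [dyckT * _]mulrC.
  exact: cvg_conv (weight_catw R) half01 coef_dyckT_le TB (@coef_sqrt1X_cvg R).
have Nl : fps_coef n dyckN / catw R n @[n --> \oo] --> - 2^-1 * B.
  (* dyckN and dyckD differ by a polynomial of degree 2. *)
  apply: (cvg_eventually_eq (m := 3%N) _ Dl) => -[|[|[|n]]] // _.
  rewrite /dyckN (_ : (1 - cX) * (1 - 3 * cX) =
      1 - cX * (fps_const 4 - cX * fps_const 3)); last by rewrite !rmorph_nat; ring.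
  rewrite (coef_fpsB dyckD) (coef_fpsB 1) coef_fps1 coef_cXM.
  by rewrite (coef_fpsB (fps_const 4)) coef_cXM !coef_fpsC !(mulr0, subr0).
(* The denominator is (1 - u X) (1 - v X); since u > 1, its zero 1 / u is a
   removable singularity. *)
pose s2 := Num.sqrt (2 : R).
have s2E : s2 ^+ 2 = 2 by rewrite sqr_sqrtr.
have s20 : 0 <= s2 by rewrite sqrtr_ge0.
have s2b : 1 < s2 < 2 by apply/andP; split; nra.
pose u := r * (2 + s2); pose v := r * (2 - s2).
have uvD : u + v = 4 * r by rewrite /u /v; ring.
have uvM : u * v = 2 * r ^+ 2.
  by transitivity (r ^+ 2 * (4 - s2 ^+ 2)); [rewrite /u /v; ring|rewrite s2E; ring].
have uv1 : (u - 1) * (1 - v) = r ^+ 4.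
  by transitivity (u + v - u * v - 1); [ring|rewrite uvD uvM; lra].
have v01 : 0 <= v < 1.
  by rewrite /v; case/andP: s2b => ? ?; apply/andP; split; nra.
have u1 : 1 < u.
  have v1 : 0 < 1 - v by case/andP: v01; lra.
  by rewrite -subr_gt0 -(pmulr_lgt0 _ v1) uv1.
pose g := (1 - fps_const v * fpsX R) * (2 * dyckf).
have gE : (1 - fps_const u * fpsX R) * g = dyckN.
  rewrite -dyckf_num /g mulrA mulrC; congr (_ * _).
  transitivity (1 - (fps_const (u + v)) * fpsX R + fps_const (u * v) * fpsX R ^+ 2).
    by rewrite (rmorphD (@fps_const R) u v) (rmorphM (@fps_const R) u v) /=; ring.
  by rewrite uvD uvM /cX !(rmorphXn, rmorphM) /= !rmorph_nat; ring.
have fg : 2 * dyckf = g * fps_geom v.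
  by rewrite /g mulrAC fps_geomE mul1r.
pose K := 2 * r / (1 - 3 * r).
have fK n : `|fps_coef n (2 * dyckf)| <= 2 * K.
  rewrite -(rmorph_nat (@fps_const R)) coef_fpsCM normrM ger0_norm //.
  by rewrite ler_pM2l // ger0_norm ?coef_dyckf_le // dyckf_ge0.
have gK n : `|fps_coef n g| <= 4 * K.
  rewrite /g mulrBl mul1r -mulrA coef_fpsB coef_fpsCM coef_fpsXM.
  have K0 : 0 <= 2 * K by apply: le_trans (fK 0%N).
  apply: le_trans (ler_normB _ _) _; rewrite normrM (ger0_norm (proj1 (andP v01))).
  have -> : 4 * K = 2 * K + 1 * (2 * K) by ring.
  rewrite lerD // ler_pM //; first by case/andP: v01.
    by case/andP: v01 => _ /ltW.
  by case: n => [|n]; rewrite ?normr0.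
have gl := cvg_div_gt1 (weight_catw R) u1 gK gE Nl.
have geomv : series (fun n => fps_coef n (fps_geom v)) @ \oo --> 1 / (1 - v).
  have vn : `|v| < 1 by case/andP: v01 => v0 v1; rewrite ger0_norm.
  apply: (cvg_eventually_eq (m := 0%N) _ (cvg_geometric_series (a := 1) vn)) => n _.
  by rewrite /series /=; apply: eq_bigr => i _; rewrite mul1r.
have vK n : `|fps_coef n (fps_geom v)| <= 1 * v ^+ n.
  by rewrite mul1r ger0_norm // exprn_ge0 //; case/andP: v01.
have fl := cvg_conv (weight_catw R) v01 vK geomv gl.
rewrite -fg in fl.
pose proof (@cvgMl_tmp _ _ _ _ _ 2^-1 _ fl) as h.
have -> : B / (4 * r ^+ 4) = 2^-1 * (- (- 2^-1 * B / (u - 1)) * (1 / (1 - v))).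
  rewrite -uv1; case/andP: v01 => v0 v1; field.
  by rewrite !lt0r_neq0 //; lra.
apply: (cvg_eventually_eq (m := 0%N) _ h) => n _.
rewrite -(rmorph_nat (@fps_const R)) coef_fpsCM -mulrA mulKf //.
Qed.

End Growth.

(** The polynomial changes sign on [0, 3/10]. *)
Lemma smallest_root_bounds (R : realType) (rho : R) :
  smallest_positive_root (rho_poly R) rho ->
  [/\ 0 < rho, rho <= 3 / 10 & 4 * rho = 1 + 2 * rho ^+ 2 + rho ^+ 4].
Proof.
move=> [rho0 /rootP rr rmin].
have pE x : (rho_poly R).[x] = 1 - 4 * x + 2 * x ^+ 2 + x ^+ 4.
  by rewrite !(hornerD, hornerN, hornerZ, hornerXn, hornerX, hornerC).
split=> //; last by move: rr; rewrite pE; lra.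
have b0 : 0 <= 3 / 10 :> R by lra.
have [|x /andP[x0 x1]] := @poly_ivt _ (- rho_poly R) 0 (3 / 10) b0.
  by rewrite !hornerN !pE; apply/andP; split; lra.
rewrite rootN => rx; apply: le_trans (rmin x _ rx) x1.
rewrite lt_neqAle x0 andbT; apply/eqP => x00.
by move: rx => /rootP; rewrite pE -x00; lra.
Qed.

Theorem theorem3p6 (R : realType) (rho : R)
    (rhoP : smallest_positive_root (rho_poly R) rho) :
  asymp_equiv (fun n : nat => (num_m1dyck n)%:R : R)
    (fun n : nat =>
       rho ^- n / Num.sqrt (n%:R ^+ 3 * pi)
       * (Num.sqrt (rho * (4 - 4 * rho - 4 * rho ^+ 3))
          / (4 * (- 1 + 4 * rho - 2 * rho ^+ 2)))).
Proof.
have [r0 r1 rE] := smallest_root_bounds rhoP.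
have r4 : 0 < rho ^+ 4 by rewrite exprn_gt0.
have [B [B0 B2] fl] := dyckf_cvg r0 r1 rE.
have -> : rho * (4 - 4 * rho - 4 * rho ^+ 3) = B ^+ 2.
  by rewrite B2; transitivity (4 * rho - 4 * rho ^+ 2 - 4 * rho ^+ 4); [ring|lra].
have -> : - 1 + 4 * rho - 2 * rho ^+ 2 = rho ^+ 4 by rewrite rE; ring.
rewrite sqrtr_sqr gtr0_norm //.
pose proof (cvgM (cvgM fl (@catw_cvg R)) (cvg_cst (4 * rho ^+ 4 / B))) as h.
have one : B / (4 * rho ^+ 4) * 1 * (4 * rho ^+ 4 / B) = 1.
  by field; rewrite !gt_eqF.
rewrite one in h.
apply: (cvg_eventually_eq (m := 1%N) _ h) => -[//|n] _.
rewrite num_m1dyckE.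
have fE : fps_coef n.+1 (dyckf rho) = (ntrees good n.+1)%:R * rho ^+ n.+1.
  by rewrite coef_fpsB coef_fps1 subr0.
have w0 := catw_gt0 R n.+1.
have s0 : 0 < Num.sqrt (n.+1%:R ^+ 3 * pi : R).
  by rewrite sqrtr_gt0 mulr_gt0 ?exprn_gt0 ?pi_gt0.
rewrite -[LHS]/(fps_coef n.+1 (dyckf rho) / catw R n.+1
  * (catw R n.+1 * Num.sqrt (n.+1%:R ^+ 3 * pi)) * (4 * rho ^+ 4 / B)) fE.
have rn : 0 < rho ^+ n.+1 by rewrite exprn_gt0.
move: (Num.sqrt _) (catw _ _) (rho ^+ n.+1) s0 w0 rn => s w t s0 w0 t0.
by field; rewrite !gt_eqF.
Qed.
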